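(* Let $a\ge 1$ and $b\ge 0$ be integers such that either (1) $a+b$ is odd and $(a,b)\neq(2,1)$, or (2) $a$ is even and $b$ is divisible by $4$. Let $n=2a+b+1$, and let $G=\mathfrak{S}_n$ in case (1) and $G=A_n$ in case (2). Let $Y=\widetilde{\mathrm{puz}}_0(\theta_{a,b})$, $K=\{\mathrm{id},\rho,\psi,\rho\psi\}$, $Z=Y/K$, and $X_{\langle\rho\rangle}=Y/\langle\rho\rangle$, $X_{\langle\psi\rangle}=Y/\langle\psi\rangle$, $X_{\langle\rho\psi\rangle}=Y/\langle\rho\psi\rangle$ (so that $X_{\langle\rho\rangle}\cong X(G,S_1)$ and $X_{\langle\psi\rangle}\cong X(G,S_2)$). Writing $P_\Gamma(x)$ for the characteristic polynomial of the adjacency matrix of $\Gamma$, one has $$\frac{P_{X_{\langle\rho\rangle}}(x)}{P_Z(x)}=(-1)^{|G|/2}\,\frac{P_{X_{\langle\psi\rangle}}(-x)}{P_Z(-x)}$$ and $$P_{X_{\langle\rho\psi\rangle}}(x)=(-1)^{|G|/2}P_Z(x)P_Z(-x).$$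
   Context: Theta graph. For integers $a\ge1$, $b\ge0$ put $n=2a+b+1$. The graph $\theta_{a,b}$ is the undirected simple graph with vertex set $V=\{v_0,\dots,v_n\}$ and edges $\{v_i,v_{i+1}\}$ for $i\in\{0,1,\dots,n-1\}\setminus\{2a+1\}$, together with $\{v_0,v_{2a+1}\}$, $\{v_0,v_{2a+2}\}$ and $\{v_{2a+b+1},v_{a+1}\}$; when $b=0$ the last two edges are replaced by the single edge $\{v_0,v_{a+1}\}$. Involutions. $\rho:V\to V$ is given by $\rho(v_i)=v_{(i+a+1)\bmod(2a+2)}$ for $0\le i\le 2a+1$ and $\rho(v_i)=v_{4a+b+3-i}$ for $2a+2\le i\le 2a+b+1$. $\psi:V\to V$ is given by $\psi(v_i)=v_{a+1-i}$ for $0\le i\le a+1$, $\psi(v_i)=v_{3a+3-i}$ for $a+2\le i\le 2a+1$, and $\psi(v_i)=v_{4a+b+3-i}$ for $2a+2\le i\le 2a+b+1$. $K=\{\mathrm{id},\rho,\psi,\rho\psi\}$ is a Klein four-group of automorphisms of $\theta_{a,b}$. Generating sets. Permutations are composed as functions (right to left). For a path $p=(w_0,\dots,w_l)$ in $\theta_{a,b}$ let $\sigma_p=(w_0,w_1)(w_1,w_2)\cdots(w_{l-1},w_l)$, a product of transpositions of $V$. Let $p_1=(v_0,v_1,\dots,v_{a+1})$, $p_2=(v_0,v_{2a+2},\dots,v_{2a+b+1},v_{a+1})$ (which is $(v_0,v_{a+1})$ if $b=0$), $p_3=(v_0,v_{2a+1},v_{2a},\dots,v_{a+1})$. The permutations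 $\sigma_{p_k}\rho$, $\sigma_{p_k}\psi$ fix $v_0$; define $\sigma_k,\tau_k\in\mathfrak{S}_n$ by $\sigma_{p_k}\rho(v_i)=v_{\sigma_k(i)}$, $\sigma_{p_k}\psi(v_i)=v_{\tau_k(i)}$ ($1\le i\le n$, $k=1,2,3$). Put $S_1=\{\sigma_1,\sigma_2,\sigma_3\}$, $S_2=\{\tau_1,\tau_2,\tau_3\}$. For a group $G$ and $S\subset G$, $X(G,S)=\mathtt{Cay}(G,S)$ is the directed graph with vertex set $G$ and an edge from $g$ to $h$ iff $h=gk$ for some $k\in S$. Puzzle graph. A position is a bijection $f:V\to\{1,\dots,n,0\}$; the vertex $f^{-1}(0)$ is called blank. $\mathrm{puz}(\theta_{a,b})$ is the graph whose vertices are all positions, with $f,g$ joined by an edge iff $g=f\circ(v,w)$ for adjacent vertices $v,w$ of $\theta_{a,b}$ one of which is blank in $f$. $\mathrm{puz}_0(\theta_{a,b})$ is the connected component containing the position $f_0$, $f_0(v_i)=i$. $\widetilde{\mathrm{puz}}_0(\theta_{a,b})$ is its path contraction, obtained by repeatedly removing a vertex of degree two and replacing its two incident edges by one edge joining its two neighbours, until no vertex of degree two remains; its vertices are the positions in $\mathrm{puz}_0(\theta_{a,b})$ with blank at $v_0$ or $v_{a+1}$. It is regarded as a bi-directed graph: each undirected edge gives two directed edges of opposite directions. Quotients. Under the stated hypotheses on $(a,b)$, $K$ acts from the right on $Y=\widetilde{\mathrm{puz}}_0(\theta_{a,b})=(V_Y,E_Y)$ by graph automorphisms via $f\mapsto f\circ\kappa$,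 $\kappa\in K$. For a subgroup $H\subset K$, $Y/H$ is the graph (possibly with loops and multiple edges) whose vertex set is the set of $H$-orbits $V_Y/H$ and whose set of directed edges is $E_Y/H$, the orbit of an edge from $f$ to $g$ being an edge from $fH$ to $gH$. The adjacency matrix of a graph has $(x,y)$ entry equal to the number of directed edges from $x$ to $y$, and $P_\Gamma(x)=\det(xI-A)$. *)

(* Defs.v *)
From mathcomp Require Export all_boot all_order all_algebra.
From mathcomp Require Export all_fingroup all_solvable.
From mathcomp Require Export finmap.
From mathcomp Require Import zify.

From mathcomp Require Export fraction.

Set Implicit Arguments.
Unset Strict Implicit.
Unset Printing Implicit Defensive.

Import GRing.Theory.

Local Open Scope nat_scope.

(* [(s * t)%g] in MathComp applies [s] first; [s \c t] is the composition of
   functions, which applies [t] first. *)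
Definition pcomp (T : finType) (s t : {perm T}) : {perm T} := (t * s)%g.
Notation "p %:F" := (FracField.tofrac p) : ring_scope.
Notation "s \c t" := (pcomp s t) (at level 40, left associativity).

(** * Finite directed multigraphs *)

Record mgraph (T : finType) (E : choiceType) := MGraph {
  vert : {set T};
  edge : {fset E};
  src : E -> T;
  tgt : E -> T }.

Definition adjacency (T : finType) (E : choiceType) (G : mgraph T E) :
    'M[rat]_#|vert G| :=
  (\matrix_(i, j)
     #|` [fset e in edge G |
           (src G e == enum_val i) && (tgt G e == enum_val j)]%fset|%:R)%R.

Definition charpol (T : finType) (E : choiceType) (G : mgraph T E) :
    {poly rat} :=
  char_poly (adjacency G).

Definition mgraph_iso (T T' : finType) (E E' : choiceType)
    (G : mgraph T E) (G' : mgraph T' E') : Prop :=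
  exists (phi : T -> T') (chi : E -> E'),
    [/\ {in vert G &, injective phi}, phi @: vert G = vert G',
        {in edge G &, injective chi}, [fset chi e | e in edge G]%fset = edge G'
      & forall e, e \in edge G ->
          src G' (chi e) = phi (src G e) /\ tgt G' (chi e) = phi (tgt G e)].

(* The orbits are taken along two families of maps indexed by [h \in H], meant
   to be an action on [G]; then the source of an orbit of edges is the image of
   that orbit under [src G], which is a single orbit of vertices. *)
Definition quotient_graph (T I : finType) (E : choiceType) (G : mgraph T E)
    (H : {set I}) (actV : T -> I -> T) (actE : E -> I -> E) :
    mgraph {set T} {fset E} :=
  MGraph [set [set actV x h | h in H] | x in vert G]
         [fset [fset actE e h | h in H] | e in edge G]%fset
         (fun O => [set x | has (fun e => src G e == x) O])
         (fun O => [set x | has (fun e => tgt G e == x) O]).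

Definition cayley (T : finType) (G S : {set {perm T}}) :
    mgraph {perm T} ({perm T} * {perm T})%type :=
  MGraph G
    [fset gh in {: {perm T} * {perm T}} |
       [&& gh.1 \in G, gh.2 \in G & [exists k in S, gh.2 == gh.1 \c k]]]%fset
    fst snd.

(** * Path contraction *)

(* An undirected graph is stored as the directed graph with both directions of
   each edge.  Each directed edge is a walk [(x, s)], which visits [x] and then
   the items of [s]; an edge created by a contraction is the concatenation of
   the two edges it replaces, so that parallel edges stay distinct. *)
Definition walk (T : finType) : choiceType := (T * seq T)%type.

Section Contraction.
Local Open Scope fset_scope.
Variable T : finType.
Implicit Types (v : T) (d : walk T) (G : mgraph T (walk T)).

Definition wsrc d : T := d.1.
Definition wtgt d : T := last d.1 d.2.
Definition wrev d : walk T := (wtgt d, rev (belast d.1 d.2)).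
Definition wcat d d' : walk T := (d.1, d.2 ++ d'.2).

Definition walk_graph (W : {set T}) (D : {fset walk T}) : mgraph T (walk T) :=
  MGraph W D wsrc wtgt.

Definition degree G v : nat := #|` [fset d in edge G | wsrc d == v]|.

Definition has_loop G v : bool :=
  has (fun d => (wsrc d == v) && (wtgt d == v)) (edge G).

(* A loop counts twice in the degree; a vertex whose only edge is a loop does
   not have two incident edges to be merged. *)
Definition suppressible G v : bool := (degree G v == 2) && ~~ has_loop G v.

Definition suppress G v : mgraph T (walk T) :=
  walk_graph (vert G :\ v)
    ([fset d in edge G | (wsrc d != v) && (wtgt d != v)]
     `|` [fset wcat d d' | d in [fset d in edge G | wtgt d == v],
            d' in [fset d' in edge G | (wsrc d' == v) && (d' != wrev d)]]).

Definition contract_step G : mgraph T (walk T) :=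
  if [pick v in vert G | suppressible G v] is Some v then suppress G v else G.

(* Each effective step removes a vertex, so [#|vert G|] steps are enough to
   exhaust the vertices of degree two. *)
Definition path_contraction G : mgraph T (walk T) :=
  iter #|vert G| contract_step G.

End Contraction.

(** * Puzzle graphs *)

(* Vertices and labels both range over {0, ..., n}, so a position is a
   permutation; the label [ord0] is the blank. *)
Section Puzzle.
Local Open Scope fset_scope.
Variables (n : nat) (e : rel 'I_n.+1).
Notation position := {perm 'I_n.+1}.

Definition puz : rel position := fun f g =>
  [exists v, exists w,
     [&& e v w, (f v == ord0) || (f w == ord0) & g == f \c tperm v w]].

Definition puz0 : mgraph position (walk position) :=
  let W := [set f | connect puz 1%g f] in
  walk_graph W
    [fset ((f, [:: g]) : walk position) | f in W, g in [set g in W | puz f g]].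

Definition puz0_contraction : mgraph position (walk position) :=
  path_contraction puz0.

Definition act_position (f : position) (k : position) : position := f \c k.

Definition act_walk (d : walk position) (k : position) : walk position :=
  (act_position d.1 k, [seq act_position f k | f <- d.2]).

End Puzzle.

(** * The theta graph *)

Section Theta.
Variables a b : nat.

Definition nlab : nat := 2 * a + b + 1.

Definition vtx (i : nat) : 'I_nlab.+1 := inord i.

Definition theta_edges : seq (nat * nat) :=
  [seq (i, i.+1) | i <- iota 0 nlab & i != 2 * a + 1]
  ++ (0, 2 * a + 1)
  :: (if b == 0 then [:: (0, a + 1)]
      else [:: (0, 2 * a + 2); (2 * a + b + 1, a + 1)]).

Definition theta : rel 'I_nlab.+1 := fun v w =>
  ((v : nat, w : nat) \in theta_edges) || ((w : nat, v : nat) \in theta_edges).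

Definition rho_fun (v : 'I_nlab.+1) : 'I_nlab.+1 :=
  vtx (if v <= 2 * a + 1 then (v + a + 1) %% (2 * a + 2)
       else 4 * a + b + 3 - v).

Definition psi_fun (v : 'I_nlab.+1) : 'I_nlab.+1 :=
  vtx (if v <= a + 1 then a + 1 - v
       else if v <= 2 * a + 1 then 3 * a + 3 - v
       else 4 * a + b + 3 - v).

Lemma rho_fun_inj : injective rho_fun.
Proof.
have nE : nlab = 2 * a + b + 1 by [].
pose m i := if i <= 2 * a + 1 then
              if i <= a then i + a + 1 else i - (a + 1)
            else 4 * a + b + 3 - i.
have rhoE v : rho_fun v = m v :> nat.
  have := ltn_ord v; rewrite /rho_fun /vtx /m.
  move: (nat_of_ord v) => i hi.
  have hmod : i <= 2 * a + 1 -> (i + a + 1) %% (2 * a + 2) =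
                                if i <= a then i + a + 1 else i - (a + 1).
    move=> hia; case: leqP => hi2; first by rewrite modn_small; lia.
    have -> : i + a + 1 = i - (a + 1) + (2 * a + 2) by lia.
    by rewrite modnDr modn_small; lia.
  case: (leqP i (2 * a + 1)) => hia; last by rewrite inordK; lia.
  by rewrite (hmod hia) inordK //; case: ifP; lia.
apply: (can_inj (g := rho_fun)) => v; apply: val_inj; rewrite /= !rhoE.
by have := ltn_ord v; rewrite /m; move: (nat_of_ord v) => i; do ![case: ifP]; lia.
Qed.

Lemma psi_fun_inj : injective psi_fun.
Proof.
have nE : nlab = 2 * a + b + 1 by [].
pose m i := if i <= a + 1 then a + 1 - i
            else if i <= 2 * a + 1 then 3 * a + 3 - i
            else 4 * a + b + 3 - i.
have psiE v : psi_fun v = m v :> nat.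
  have := ltn_ord v; rewrite /psi_fun /vtx /m.
  by move: (nat_of_ord v) => i hi; rewrite inordK //; do ![case: ifP]; lia.
apply: (can_inj (g := psi_fun)) => v; apply: val_inj; rewrite /= !psiE.
by have := ltn_ord v; rewrite /m; move: (nat_of_ord v) => i; do ![case: ifP]; lia.
Qed.

Definition rho : {perm 'I_nlab.+1} := perm rho_fun_inj.
Definition psi : {perm 'I_nlab.+1} := perm psi_fun_inj.

Definition klein : {set {perm 'I_nlab.+1}} :=
  [set 1%g; rho; psi; rho \c psi].

(* The path is [w :: p]. *)
Fixpoint sigma_path (w : 'I_nlab.+1) (p : seq 'I_nlab.+1) :
    {perm 'I_nlab.+1} :=
  if p is w' :: p' then tperm w w' \c sigma_path w' p' else 1%g.

(* All three paths start at [vtx 0], which is omitted here. *)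
Definition path1 := map vtx (iota 1 (a + 1)).
Definition path2 := map vtx (rcons (iota (2 * a + 2) b) (a + 1)).
Definition path3 := map vtx (rev (iota (a + 1) (a + 1))).

(* The index i of v_i, 1 <= i <= n, is the element i - 1 of ['I_n], and
   [lift ord0] maps it to v_i. *)
Definition induces (pi : {perm 'I_nlab.+1}) (s : {perm 'I_nlab}) : bool :=
  [forall i, pi (lift ord0 i) == lift ord0 (s i)].

Definition generators (k : {perm 'I_nlab.+1}) : {set {perm 'I_nlab}} :=
  [set s | has (fun p => induces (sigma_path (vtx 0) p \c k) s)
               [:: path1; path2; path3]].

Definition Ygraph := puz0_contraction theta.

Definition Yquotient (H : {set {perm 'I_nlab.+1}}) :=
  quotient_graph Ygraph H (@act_position nlab) (@act_walk nlab).

End Theta.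

(* Main.v *)
Require Import Defs.
From mathcomp Require Import zify ring.

(** Off the two hubs [v_0] and [v_{a+1}] the blank has exactly two moves, so a move
    sequence that never undoes its last move follows an arc to its end. The
    contracted puzzle graph [Y] therefore has as edges the moves along whole
    arcs: this is proved by the invariant that, at each stage of the contraction,
    the edges are the non-backtracking walks between remaining vertices through
    removed ones ([contracted], [path_contractionP]). From a position [f] with the
    blank at [v_0], the three edges of [Y] lead to the positions
    [f \c sigma_path (vtx 0) p], one for each arc [p] ([arc_edge], [edge_arc]).

    The positions of [Y] with the blank at [v_0] form a group of permutations of the
    tiles. It contains the cycles along pairs of arcs; commutators of these have
    very small support, and suitable products of them give a 3-cycle, unless
    [b = 1] and [a <= 2]. Each of the cycles fixes the interior of an arc, so
    3-cycles spread to all triples of tiles and the group contains the alternating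
    group ([all_linked], [Alt_tiles]). When [a + b] is odd one of the cycles is odd
    ([tiles_Sym]); when [a] and [b] are even the graph is bipartite and the signs of
    the closed walks are even ([tiles_Alt]). A computation of signs shows that
    [rho] and [psi] are themselves reachable positions, so that the Klein group
    [K] acts on [Y].

    This action is free, and [rho] and [psi] exchange the hubs. Each orbit of [rho]
    contains one position with the blank at [v_0], and an edge followed by [rho] is
    multiplication by a generator; hence the Cayley graph, and likewise for [psi]
    ([Yquotient_cayley]).

    For the characteristic polynomials, all edges of [Y] go from one hub to the
    other. Choose representatives [r_i] of the [K]-orbits with the blank at [v_0],
    and let [B] and [C] count the edges from [r_i] to [r_j \c rho] and to
    [r_j \c psi]. Since [rho \c psi] preserves [v_0], the adjacency matrices of the
    quotients by [K], [rho], [psi] and [rho \c psi] are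
      [B + C],  [[B, C], [C, B]],  [[C, B], [B, C]],  [[0, B + C], [B + C, 0]].
    A block matrix [[P, Q], [Q, P]] has the characteristic polynomial of [P + Q]
    times that of [P - Q] ([char_poly_block]), so the polynomial of [Z] divides the
    others, with quotients the polynomials of [B - C], of [C - B] and of
    [- (B + C)] ([charpol_factors]). Negating a matrix of size [#|G| / 2] replaces
    [x] by [- x] up to the sign [(-1) ^+ (#|G| / 2)] ([char_polyN]). *)

Set Implicit Arguments.
Unset Strict Implicit.
Unset Printing Implicit Defensive.
Import GRing.Theory.
Local Open Scope nat_scope.


(** * Path contraction as a graph of non-backtracking walks *)

Section Segments.
Local Open Scope fset_scope.
Variables (T : finType) (r : rel T) (W D : {set T}).
Implicit Types (U : {set T}) (p x y z v : T) (s : seq T) (d : walk T).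

(** The predicate recurses from the front, so that both the determinism of a
    segment and its reversal are inductions on the list: [p] is the vertex
    visited before [x], and the walk must leave [x] by another edge as long as
    it has not reached [U]. *)
Fixpoint tail U p x s : bool :=
  if s is y :: s' then [&& x \notin U, r x y, y != p & tail U x y s']
  else x \in U.

Fixpoint nbwalk p x s : bool :=
  if s is y :: s' then [&& r x y, y != p & nbwalk x y s'] else true.

(** The edges that remain once all the vertices outside [U] are suppressed. *)
Definition segment U d : bool :=
  (d.1 \in U) && if d.2 is y :: s then r d.1 y && tail U d.1 y s else false.

Hypothesis rsym : symmetric r.
Hypothesis Wclosed : forall x y, x \in W -> r x y -> y \in W.
Hypothesis DW : D \subset W.
Hypothesis degree2 : forall x, x \in W -> x \notin D -> #|[pred y | r x y]| = 2.
Hypothesis degree3 : forall x, x \in D -> #|[pred y | r x y]| = 3.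
(** Off the branch vertices, the graph is a union of paths. *)
Hypothesis acyclic : forall x y s, x \in W -> r x y -> nbwalk x y s ->
  all [predC D] (x :: y :: s) -> x \notin y :: s.

Lemma tail_last U p x s : tail U p x s -> last x s \in U.
Proof. by elim: s p x => [|y s IH] p x //= /and4P[_ _ _ /IH]. Qed.

Lemma tail_nbwalk U p x s : tail U p x s -> nbwalk p x s.
Proof. by elim: s p x => [|y s IH] p x //= /and4P[_ -> -> /IH]. Qed.

Lemma tail_interior U p x s : tail U p x s -> all [predC U] (belast x s).
Proof. by elim: s p x => [|y s IH] p x //= /and4P[-> _ _ /IH]. Qed.

Lemma nbwalk_cat p x s s' : nbwalk p x (s ++ s') -> nbwalk p x s.
Proof. by elim: s p x => [|y s IH] p x //= /and3P[-> -> /IH]. Qed.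

(** Up to its first return to [v] the walk stays off [D], which [acyclic] forbids. *)
Lemma no_return U v z s : D \subset U -> v \in W -> v \notin D -> r v z ->
  tail U v z s -> v \notin z :: s.
Proof.
move=> DU vW vD vz ts; apply/negP => vzs.
have int := tail_interior ts; have := tail_nbwalk ts.
have notD x : x \in belast z s -> x \notin D.
  by move=> /(allP int) /=; apply: contra => /(subsetP DU).
have [ezv _|nzv] := eqVneq v z.
  by have := @acyclic v z [::] vW vz; rewrite /= -ezv vD inE eqxx => /(_ isT isT).
move: vzs; rewrite inE (negbTE nzv) /= => vs.
case/splitPr: vs notD => s1 s2; rewrite -cat1s catA => notD /nbwalk_cat nb.
have aD : all [predC D] (z :: s1).
  apply/allP => x xs; apply: notD; rewrite belast_cat mem_cat cats1 belast_rcons.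
  by rewrite xs.
have zD : z \notin D by case/andP: aD.
have s1D : all [predC D] s1 by case/andP: aD.
have := acyclic vW vz nb; rewrite /= vD all_cat s1D /= vD zD => /(_ isT).
by rewrite inE mem_cat inE eqxx !orbT.
Qed.

Lemma other_unique p x y z :
  x \in W -> x \notin D -> r x p -> r x y -> r x z -> y != p -> z != p -> y = z.
Proof.
move=> xW xD xp xy xz yp zp; apply/eqP/negP => /negP yz.
have := degree2 xW xD; rewrite (cardD1 p) (cardD1 y) (cardD1 z) !inE.
by rewrite xp xy xz yp zp eq_sym yz.
Qed.

Lemma other_exists p x :
  x \in W -> x \notin D -> r x p -> exists2 y, r x y & y != p.
Proof.
move=> xW xD xp; have := degree2 xW xD; rewrite (cardD1 p) !inE xp add1n => -[e].
have /card_gt0P[y] : 0 < #|[predD1 [pred y | r x y] & p]| by rewrite e.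
by rewrite !inE => /andP[yp xy]; exists y.
Qed.

Section Stage.
Variable U : {set T}.
Hypothesis DU : D \subset U.
Hypothesis UW : U \subset W.

Let notinD x : x \notin U -> x \notin D.
Proof. by apply: contra => /(subsetP DU). Qed.

Lemma tail_unique p x s s' :
  x \in W -> r x p -> tail U p x s -> tail U p x s' -> s = s'.
Proof.
elim: s s' p x => [|y s IH] [|y' s'] p x xW xp //=.
- by move=> ->.
- by move=> /and4P[/negbTE->].
move=> /and4P[xU xy yp ts] /and4P[_ xy' y'p ts'].
have e := other_unique xW (notinD xU) xp xy xy' yp y'p.
by subst y'; congr (_ :: _); apply: IH ts ts'; [apply: Wclosed xy|rewrite rsym].
Qed.

(** After its first step a segment has no choice, since its interior avoids [D]. *)
Lemma segment_unique d d' :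
  segment U d -> segment U d' -> d.1 = d'.1 ->
  head d.1 d.2 = head d'.1 d'.2 -> d = d'.
Proof.
case: d d' => [x [|y s]] [x' [|y' s']]; rewrite /segment /= ?andbF //.
move=> /and3P[xU xy ts] /and3P[_ _ ts'] ex ey; subst.
congr (_, _ :: _); apply: tail_unique ts ts'; last by rewrite rsym.
by apply: Wclosed xy; apply: (subsetP UW).
Qed.

(** An open walk, still outside [U] after as many steps as there are vertices,
    would have to come back to one of its vertices. *)
Lemma tail_exists p x : x \in W -> r x p -> exists s, tail U p x s.
Proof.
pose fix open p x s := if s is y :: s' then
  [&& x \notin U, r x y, y != p & open x y s'] else x \notin U.
have openU q y s : open q y s -> forall z, z \in y :: s -> z \notin U.
  elim: s q y => [|z s IH] q y /=; first by move=> yU z; rewrite inE => /eqP->.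
  by move=> /and4P[yU _ _ /IH h] u; rewrite inE => /orP[/eqP->|/h].
have open_uniq q y s : y \in W -> open q y s -> uniq (y :: s).
  elim: s q y => [|z s IH] q y yW //= /and4P[yU yz zq os].
  have zW := Wclosed yW yz.
  rewrite -/(uniq (z :: s)) (IH y z) ?andbT //.
  have onb : nbwalk y z s.
    by elim: (s) (y) (z) os => [|u s' IHs] q' y' //= /and4P[_ -> -> /IHs].
  apply: acyclic => //; apply/allP => u; rewrite inE.
  by case/orP=> [/eqP->|/(openU _ _ _ os)]; [exact: notinD|move/notinD].
move=> xW xp.
have step k : forall p x, x \in W -> r x p ->
    (exists s, tail U p x s) \/ (exists2 s, size s = k & open p x s).
  elim: k => [|k IH] q y yW yq; have [yU|yU] := boolP (y \in U).
  - by left; exists [::].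
  - by right; exists [::].
  - by left; exists [::].
  have [z yz zq] := other_exists yW (notinD yU) yq.
  have [||[s ts]|[s es os]] := IH y z; first exact: Wclosed yz.
  - by rewrite rsym.
  - by left; exists (z :: s); rewrite /= yU yz zq.
  - by right; exists (z :: s); rewrite /= ?es // yU yz zq.
have [//|[s es os]] := step #|T| _ _ xW xp.
have /card_uniqP e := open_uniq _ _ _ xW os.
by have := max_card (mem (x :: s)); rewrite e /= es ltnn.
Qed.

Lemma segment_exists x y :
  x \in U -> r x y -> exists s, segment U (x, y :: s).
Proof.
move=> xU xy; have [||s ts] := @tail_exists x y; last first.
- by exists s; rewrite /segment /= xU xy.
- by rewrite rsym.
- by apply: Wclosed xy; apply: (subsetP UW).
Qed.

Lemma segment_rev d : segment U d -> segment U (wrev d).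
Proof.
case: d => x [|y s]; rewrite /segment /= ?andbF // => /and3P[xU xy ts].
rewrite /wrev /wtgt /=.
have -> : rev (x :: belast y s) = rev (belast x (y :: s)) ++ [::].
  by rewrite cats0.
have tx : tail U y x [::] by [].
(* The part of the walk already reversed is accumulated in the last argument. *)
move: {xU} ts tx xy; elim: s x y [::] => [|z s IH] x y t /=.
  by move=> yU tx xy; rewrite yU rsym xy.
move=> /and4P[yU yz zx ts] tx xy.
have := IH y z (x :: t) ts; rewrite /= yU rsym xy eq_sym zx tx => /(_ isT yz).
by rewrite /= !rev_cons -!cats1 -!catA.
Qed.

Lemma segment_noloop d : segment U d -> d.1 \notin D -> wtgt d != d.1.
Proof.
case: d => x [|y s]; rewrite /segment /= ?andbF // => /and3P[xU xy ts] xD.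
have := no_return DU (subsetP UW _ xU) xD xy ts.
by apply: contra => /eqP <-; rewrite /wtgt /= mem_last.
Qed.

(** Each neighbour of [v] is the first step of exactly one segment, so that the
    degrees survive all the contractions. *)
Lemma card_segments v : v \in U -> forall (F : {fset walk T}),
  (forall d, (d \in F) = segment U d && (d.1 == v)) ->
  #|` F| = #|[pred y | r v y]|.
Proof.
move=> vU F FE.
have [g gE] : exists g : T -> seq T, forall y, r v y -> segment U (v, y :: g y).
  apply: (@fin_all_exists _ (fun=> seq T)
            (fun y s => r v y -> segment U (v, y :: s))) => y.
  have [vy|nvy] := boolP (r v y); last by exists [::].
  by have [s ss] := segment_exists vU vy; exists s.
have -> : F = [fset ((v, y :: g y) : walk T) | y in [pred y | r v y]].
  apply/fsetP => d; rewrite FE; apply/andP/imfsetP => /= [[dU /eqP dv]|[y]].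
    case: d dU dv => x [|y s] dU /= dv; first by case/andP: dU.
    subst x; have vy : r v y by case/and3P: dU.
    by exists y => //; apply: segment_unique; rewrite ?gE.
  by move=> vy ->; split; rewrite ?gE /=.
rewrite card_in_imfset /=; first by rewrite -cardE.
by move=> y z _ _ [].
Qed.

End Stage.

(** The invariant of the contraction: the edges are the segments between the
    vertices that are still present. *)
Definition contracted (G : mgraph T (walk T)) : Prop :=
  [/\ D \subset vert G, vert G \subset W, src G = @wsrc T, tgt G = @wtgt T
    & forall d, (d \in edge G) = segment (vert G) d].

Lemma contracted_degree G v : contracted G -> v \in vert G ->
  degree G v = #|[pred y | r v y]|.
Proof.
move=> [DU UW _ _ EG] vG; apply: (card_segments DU UW vG) => d.
by rewrite !inE /= EG.
Qed.

Lemma contracted_suppressible G v : contracted G -> v \in vert G ->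
  suppressible G v = (v \notin D).
Proof.
move=> cG vG; rewrite /suppressible (contracted_degree cG vG).
have [vD|vD] := boolP (v \in D); first by rewrite degree3.
have [DU UW _ _ EG] := cG.
rewrite degree2 ?(subsetP UW) //=; apply/hasPn => d; rewrite EG => dG.
by apply/negP => /andP[/eqP dv /eqP dt];
   have := segment_noloop DU UW dG; rewrite -/(wsrc d) dt dv eqxx => /(_ vD).
Qed.

Lemma tail_split U v p y s : v \in U -> tail (U :\ v) p y s ->
  tail U p y s \/ exists s1 z s2, s = s1 ++ z :: s2 /\
    [/\ tail U p y s1, last y s1 = v, z != last p (belast y s1), r v z
      & tail (U :\ v) v z s2].
Proof.
move=> vU; elim: s p y => [|z s IH] p y /=.
  by rewrite !inE => /andP[_ yU]; left.
move=> /and4P[yU yz zp ts]; have [eyv|nyv] := eqVneq y v.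
  by subst y; right; exists [::], z, s.
move: yU; rewrite !inE nyv /= => yU; rewrite yU yz zp /=.
have [->|[s1 [u [s2 [-> [ts1 l1 un vu ts2]]]]]] := IH _ _ ts; first by left.
by right; exists (z :: s1), u, s2; rewrite /= yU yz zp.
Qed.

Lemma tail_setD1 U v p z s :
  v \notin z :: s -> tail (U :\ v) p z s = tail U p z s.
Proof.
elim: s p z => [|y s IH] p z; first by rewrite /= !inE eq_sym => ->.
rewrite inE negb_or => /andP[nvz vs] /=.
by rewrite IH // !inE eq_sym nvz.
Qed.

Lemma tail_cat U v p y s1 z s2 : tail U p y s1 -> last y s1 = v -> v \in U ->
  z != last p (belast y s1) -> r v z -> tail U v z s2 -> v \notin z :: s2 ->
  tail (U :\ v) p y (s1 ++ z :: s2).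
Proof.
move=> ts1 l1 vU zn vz ts2 vs2.
have t2 : tail (U :\ v) v z s2 by rewrite tail_setD1.
elim: s1 p y ts1 l1 zn => [|u s IH] p y /=.
  by move=> yU -> zp; rewrite vz zp t2 !inE eqxx.
by move=> /and4P[yU -> -> ts] l1 zn; rewrite (IH y u) // !inE negb_and yU orbT.
Qed.

Lemma wrev_head (x y : T) s : (wrev (x, y :: s)).1 = last y s /\
  head (last y s) (wrev (x, y :: s)).2 = last x (belast y s).
Proof.
rewrite /wrev /wtgt /=; split=> //.
by case: (lastP (belast y s)) => [|t u] //; rewrite -rcons_cons rev_rcons last_rcons.
Qed.

(** A segment between the vertices other than [v] meets [v] at most once, and
    splits there into two segments. Conversely the concatenation of two segments
    at [v] could backtrack only if the second one left [v] by the edge by which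
    the first one arrived, and the reverse of the first is the only such segment. *)
Lemma contracted_suppress G v : contracted G -> v \in vert G -> v \notin D ->
  contracted (suppress G v).
Proof.
move=> cG vG vD; have [DU UW sG tG EG] := cG; set U := vert G in DU UW EG vG *.
have vW := subsetP UW _ vG.
split => //=.
- by rewrite subsetD1 DU.
- by apply: subset_trans UW; apply: subD1set.
have DU' : D \subset U :\ v by rewrite subsetD1 DU.
move=> d; rewrite in_fsetU; apply/orP/idP => [[|]|].
- rewrite !inE /= EG => /and3P[dU ds dt].
  case: d dU ds dt => x [|y s]; rewrite /segment /= ?andbF // /wtgt /wsrc /=.
  move=> /and3P[xU xy ts] nx nl; rewrite !inE nx xU xy /=.
  elim: s (x) y {xy} ts nl => [|z s IH] q y /=.
    by move=> yU nyv; rewrite !inE nyv.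
  by move=> /and4P[yU -> -> ts] nl; rewrite IH // !inE negb_and yU orbT.
- case/imfset2P => /= d1; rewrite !inE /= EG => /andP[d1U d1v] [d2].
  rewrite !inE /= EG => /and3P[d2U d2v nrev] ->.
  have nl1 : d1.1 != v.
    apply/eqP => e; have := segment_noloop DU UW d1U; rewrite e (eqP d1v) eqxx.
    by move=> /(_ vD).
  have rU := segment_rev d1U.
  have rdiff : head v d2.2 != head v (wrev d1).2.
    apply: contra nrev => /eqP e; apply/eqP.
    have d2e : d2.1 = v := eqP d2v.
    have d1e : (wrev d1).1 = v := eqP d1v.
    by apply: (segment_unique DU UW d2U rU); rewrite ?d2e ?d1e.
  case: d1 d1U d1v nl1 {nrev rU} rdiff => x [|y s1]; rewrite /segment /= ?andbF //.
  move=> /and3P[xU xy ts1] /eqP l1 nx; rewrite /wtgt /= in l1.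
  case: d2 d2U d2v => w [|z s2]; rewrite /segment /= ?andbF // /wsrc /=.
  move=> /and3P[_ vz ts2] /eqP ew; subst w.
  have [_] := wrev_head x y s1; rewrite l1 => -> nz.
  rewrite !inE nx xU xy /=; apply: (tail_cat ts1 l1) => //.
  exact: no_return ts2.
- move=> dU; have [x [y [s ed]]] : exists x y s, d = (x, y :: s).
    by case: d dU => x [|y s]; [case/andP | exists x, y, s].
  move: dU; rewrite {1}ed => /and3P[/setD1P[nx xU] xy ts].
  have [ts'|[s1 [z [s2 [es [ts1 l1 zn vz ts2]]]]]] := tail_split vG ts.
    left; rewrite !inE /= EG ed /segment /= xU xy ts' nx /wtgt /=.
    by have := tail_last ts; rewrite !inE => /andP[].
  right; apply/imfset2P; exists ((x, y :: s1) : walk T).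
    by rewrite !inE /= EG /segment /= xU xy ts1 /wtgt /= l1 eqxx.
  exists ((v, z :: s2) : walk T); last by rewrite /wcat /= ed es.
  have nr := no_return DU' vW vD vz ts2.
  have ts2' : tail U v z s2 by rewrite -(tail_setD1 _ _ nr).
  rewrite !inE /= EG /segment /= vG vz ts2' /wsrc /= eqxx /=.
  apply: contra zn => /eqP e; have [_] := wrev_head x y s1.
  by rewrite l1 -e /= => ->.
Qed.

Lemma contracted_step G : contracted G ->
  contracted (contract_step G) /\
  (vert (contract_step G) = D \/ #|vert (contract_step G)| < #|vert G|).
Proof.
move=> cG; have [DU UW _ _ EG] := cG; rewrite /contract_step.
case: pickP => [v /andP[vG]|none].
  rewrite (contracted_suppressible cG vG) => vD.
  split; first exact: contracted_suppress.
  by right; rewrite /= [X in _ < X](cardsD1 v) vG.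
split=> //; left; apply/eqP; rewrite eqEsubset DU andbT; apply/subsetP => v vG.
have := none v; rewrite /= vG (contracted_suppressible cG vG) /=.
by move/negbFE.
Qed.

(** A step that changes the graph removes a vertex, and there is such a step as
    long as a vertex off [D] remains, whatever the order of the choices. *)
Lemma path_contractionP G : contracted G ->
  contracted (path_contraction G) /\ vert (path_contraction G) = D.
Proof.
move=> cG; rewrite /path_contraction.
have H k : contracted (iter k (@contract_step T) G) /\
    (vert (iter k (@contract_step T) G) = D \/
     #|vert (iter k (@contract_step T) G)| + k <= #|vert G|).
  elim: k => [|k [cGk IH]]; first by split=> //; right; rewrite addn0.
  rewrite iterS; have [cGk1 lt] := contracted_step cGk; split=> //.
  case: lt => [|lt]; first by left.
  case: IH => [e|le]; last by right; lia.
  have [/subset_leq_card DU _ _ _ _] := cGk1.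
  by move: lt; rewrite e ltnNge DU.
have [cG' [->|le]] := H #|vert G|; split=> //; apply/eqP; rewrite eq_sym.
have [DU _ _ _ _] := cG'; rewrite eqEcard DU.
by apply: leq_trans (leq0n _); lia.
Qed.

End Segments.

(** * The puzzle on a theta graph *)

Section ThetaGraph.
Variables a b : nat.
Notation n := (nlab a b).
Notation vtx := (@vtx a b).
Implicit Types (v w : 'I_n.+1).

Let nE : n = 2 * a + b + 1. Proof. by []. Qed.

Lemma vtxE i : i <= n -> vtx i = i :> nat.
Proof. by move=> le_in; rewrite /vtx /Defs.vtx inordK. Qed.

Lemma vtx0 : vtx 0 = ord0.
Proof. by apply: val_inj; rewrite /= vtxE. Qed.

Lemma vtx_id v : vtx v = v.
Proof. by apply: val_inj; rewrite /= vtxE // -ltnS. Qed.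

(** Each edge in the orientation in which it is listed. *)
Definition adjn i j : bool :=
  [|| [&& j == i.+1, i < n & i != 2 * a + 1],
      (i == 0) && (j == 2 * a + 1)
    | if b == 0 then (i == 0) && (j == a + 1)
      else (i == 0) && (j == 2 * a + 2) || (i == 2 * a + b + 1) && (j == a + 1)].

Lemma adjnP i j : reflect
  [\/ [/\ j = i.+1, i < n & i <> 2 * a + 1], i = 0 /\ j = 2 * a + 1,
      [/\ b = 0, i = 0 & j = a + 1] |
      0 < b /\ (i = 0 /\ j = 2 * a + 2 \/ i = n /\ j = a + 1)]
  (adjn i j).
Proof.
rewrite /adjn; apply: (iffP or3P) => [[/and3P[/eqP-> lt /eqP ne]|/andP[/eqP-> /eqP->]|]
    | [[-> lt ne]|[-> ->]|[-> -> ->]|[b0 [[-> ->]|[-> ->]]]]].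
- by constructor 1.
- by constructor 2.
- case: eqP => [b0 /andP[/eqP-> /eqP->]|b0]; first by constructor 3.
  by case/orP => /andP[/eqP-> /eqP->]; constructor 4; rewrite lt0n; (split; [exact/eqP|by auto]).
- by constructor 1; rewrite eqxx lt; apply/eqP.
- by constructor 2; rewrite !eqxx.
- by constructor 3; rewrite !eqxx.
- by constructor 3; rewrite !eqxx eqn0Ngt b0.
- by constructor 3; rewrite !eqxx eqn0Ngt b0 orbT.
Qed.

Lemma thetaE v w : theta v w = adjn v w || adjn w v.
Proof.
have E i j : ((i, j) \in theta_edges a b) = adjn i j.
  rewrite /theta_edges /adjn mem_cat inE xpair_eqE; congr [|| _, _ | _].
    apply/mapP/and3P => [[k]|[/eqP-> lt ne]].
      by rewrite mem_filter mem_iota => /and3P[ne _ lt] [-> ->].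
    by exists i; rewrite // mem_filter ne mem_iota.
  by case: (b == 0); rewrite !inE ?xpair_eqE.
by rewrite /theta !E.
Qed.

Lemma theta_sym : symmetric (@theta a b).
Proof. by move=> v w; rewrite !thetaE orbC. Qed.

End ThetaGraph.

(* Finds the shape of an edge, in one of its two orientations. *)
Ltac find_edge := first
  [ lia
  | left; apply/adjnP; constructor 1; split; lia
  | right; apply/adjnP; constructor 1; split; lia
  | left; apply/adjnP; constructor 2; split; lia
  | right; apply/adjnP; constructor 2; split; lia
  | left; apply/adjnP; constructor 3; split; lia
  | right; apply/adjnP; constructor 3; split; lia
  | left; apply/adjnP; constructor 4; split; lia
  | right; apply/adjnP; constructor 4; split; lia ].

Section ThetaPuzzle.
Variables a b : nat.
Hypothesis a_gt0 : 0 < a.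
Notation n := (nlab a b).
Notation position := {perm 'I_n.+1}.
Notation vtx := (@vtx a b).
Notation r := (puz (@theta a b)).
Notation adjn := (adjn a b).
Implicit Types (v w : 'I_n.+1) (f g h : position).

Let nE : n = 2 * a + b + 1. Proof. by []. Qed.

Definition hub v : bool := (v == vtx 0) || (v == vtx (a + 1)).

Lemma hubE v : hub v = ((v : nat) == 0) || ((v : nat) == a + 1).
Proof. by rewrite /hub -!val_eqE /= !vtxE //; lia. Qed.

Lemma theta_neighbours v s : uniq s ->
  (forall w, theta v w = (w \in s)) -> #|[pred w | theta v w]| = size s.
Proof. by move=> us vs; rewrite -(card_uniqP us); apply: eq_card => w; rewrite inE. Qed.

(** Inside an arc the neighbours have consecutive indices, except where the arc
    meets a hub. *)
Lemma theta_degree v : #|[pred w | theta v w]| = if hub v then 3 else 2.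
Proof.
pose nb : seq nat :=
  if v == 0 :> nat then [:: 1; 2 * a + 1; if b == 0 then a + 1 else 2 * a + 2]
  else if v == a + 1 :> nat then
    [:: a; a + 2; if b == 0 then 0 else 2 * a + b + 1]
  else [:: if v == 2 * a + 2 :> nat then 0 else v.-1;
           if v == 2 * a + 1 :> nat then 0
           else if v == 2 * a + b + 1 :> nat then a + 1 else v.+1].
have ltv := ltn_ord v.
have -> : (if hub v then 3 else 2) = size (map vtx nb).
  by rewrite size_map hubE /nb; case: (v == 0 :> nat); case: (v == a + 1 :> nat).
have nbn : all [pred i | i <= n] nb by rewrite /nb; do ?case: ifP => /=; lia.
apply: theta_neighbours.
  rewrite map_inj_in_uniq; first by rewrite /nb; do ?case: ifP; rewrite /= ?inE; lia.
  move=> i j /(allP nbn) /= lei /(allP nbn) /= lej /(congr1 val) /=.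
  by rewrite !vtxE.
move=> w; have ltw := ltn_ord w.
have lev : v <= n by []. have lew : w <= n by [].
have -> : (w \in map vtx nb) = ((w : nat) \in nb).
  apply/mapP/idP => [[i /[dup] /(allP nbn) /= lei ni ->]|wn].
    by rewrite vtxE.
  by exists (w : nat) => //; rewrite vtx_id.
rewrite thetaE; move: (v : nat) (w : nat) lev lew @nb {ltv ltw nbn} => i j lei lej nb.
rewrite {}/nb; apply/orP/idP.
  case=> /adjnP [[e ? ?]|[e e']|[? e e']|[? [[e e']|[e e']]]];
    do ![case: eqP => ?]; rewrite ?inE; lia.
have ends x y z : j \in [:: x; y; z] -> [\/ j = x, j = y | j = z].
  by rewrite !inE => /or3P[] /eqP; [constructor 1|constructor 2|constructor 3].
have ends2 x y : j \in [:: x; y] -> j = x \/ j = y.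
  by rewrite !inE => /orP[] /eqP; [left|right].
case: eqP => [i0|i0].
  by case/ends; do ?[case: eqP => ?] => e; find_edge.
case: eqP => [ia|ia].
  by case/ends; do ?[case: eqP => ?] => e; find_edge.
by case/ends2; do ?[case: eqP => ?] => e; find_edge.
Qed.

(** ** Moves of the blank *)

Definition blank f : 'I_n.+1 := (f^-1)%g ord0.

Lemma blankP f v : (f v == ord0) = (v == blank f).
Proof. by rewrite /blank -[in RHS](inj_eq (@perm_inj _ f)) permKV. Qed.

Definition slide f w : position := f \c tperm (blank f) w.

Lemma blank_slide f w : blank (slide f w) = w.
Proof. by apply/eqP; rewrite eq_sym -blankP /slide /pcomp permM tpermR blankP. Qed.

Lemma puzP f g :
  reflect (exists2 w, theta (blank f) w & g = slide f w) (r f g).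
Proof.
apply: (iffP existsP) => [[v /existsP[w /and3P[vw blk /eqP->]]]|[w fw ->]].
  move: blk; rewrite !blankP => /orP[] /eqP e; subst; first by exists w.
  by exists v; rewrite 1?theta_sym // /slide tpermC.
by exists (blank f); apply/existsP; exists w; rewrite fw blankP !eqxx.
Qed.

Lemma puzE f g : r f g = theta (blank f) (blank g) && (g == slide f (blank g)).
Proof.
apply/puzP/andP => [[w fw ->]|[fg /eqP e]]; last by exists (blank g).
by rewrite blank_slide.
Qed.

Lemma slideK f g : g = slide f (blank g) -> f = slide g (blank f).
Proof.
by move=> e; rewrite /slide {1}e /slide /pcomp tpermC mulgA tperm2 mul1g.
Qed.

Lemma puz_sym : symmetric r.
Proof.
move=> f g; rewrite !puzE theta_sym; case: (theta _ _) => //=.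
by apply/eqP/eqP; apply: slideK.
Qed.

Lemma puz_blank_inj f g h : r f g -> r f h -> blank g = blank h -> g = h.
Proof. by rewrite !puzE => /andP[_ /eqP->] /andP[_ /eqP->]; rewrite !blank_slide => ->. Qed.

Lemma puz_degree f : #|[pred g | r f g]| = if hub (blank f) then 3 else 2.
Proof.
rewrite -theta_degree -(card_image (f := slide f)).
  by apply: eq_card => g; rewrite !inE; apply/puzP/imageP => -[w]; exists w.
by move=> w w' /(congr1 blank); rewrite !blank_slide.
Qed.

Definition reachable : {set position} := [set f | connect r 1%g f].
(** The positions of degree three, by [puz_degree]; they survive the contraction. *)
Definition branch : {set position} := [set f in reachable | hub (blank f)].

Lemma reachable_step f g : f \in reachable -> r f g -> g \in reachable.
Proof. by rewrite !inE => cf /connect1; apply: connect_trans. Qed.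

Definition arc_interior : pred position := fun f => ~~ hub (blank f).

Lemma arc_step f g : r f g -> arc_interior f -> arc_interior g ->
  blank g = (blank f).+1 :> nat \/ blank f = (blank g).+1 :> nat.
Proof.
rewrite puzE /arc_interior => /andP[fg _]; move: fg; rewrite !hubE thetaE /adjn.
by case: ifP; lia.
Qed.

(** Off the hubs the blank moves along an arc, whose vertices are numbered
    consecutively; without backtracking, its index is monotonic. *)
Lemma nbwalk_increasing s f g m :
  r f g -> nbwalk r f g s -> all arc_interior (f :: g :: s) ->
  blank g = (blank f).+1 :> nat -> m < blank g ->
  all (fun h => m < blank h) (g :: s).
Proof.
elim: s f g m => [|h s IH] f g m fg nb /=; first by move=> _ _ ->.
move: nb => /= /and3P[gh hf nb] /and4P[fi gi hi si] e ltm; rewrite ltm /=.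
have gfi : all arc_interior (g :: h :: s) by rewrite /= gi hi.
have [e'|e'] := arc_step gh gi hi.
  by have lt' : m < blank h; [rewrite e' ltnS ltnW | exact: IH gh nb gfi e' lt'].
case/eqP: hf; apply: puz_blank_inj gh _ _; first by rewrite puz_sym.
by apply: val_inj; move: e' e => /=; lia.
Qed.

Lemma nbwalk_decreasing s f g m :
  r f g -> nbwalk r f g s -> all arc_interior (f :: g :: s) ->
  blank f = (blank g).+1 :> nat -> blank g < m ->
  all (fun h => blank h < m) (g :: s).
Proof.
elim: s f g m => [|h s IH] f g m fg nb /=; first by move=> _ _ ->.
move: nb => /= /and3P[gh hf nb] /and4P[fi gi hi si] e ltm; rewrite ltm /=.
have gfi : all arc_interior (g :: h :: s) by rewrite /= gi hi.
have [e'|e'] := arc_step gh gi hi; last first.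
  by have lt' : blank h < m; [rewrite -e' ltnW | exact: IH gh nb gfi e' lt'].
case/eqP: hf; apply: puz_blank_inj gh _ _; first by rewrite puz_sym.
by apply: val_inj; move: e' e => /=; lia.
Qed.

Lemma nbwalk_arc s f g : f \in reachable -> r f g -> nbwalk r f g s ->
  all [predC branch] (f :: g :: s) -> all arc_interior (f :: g :: s).
Proof.
have I x : x \in reachable -> x \notin branch -> arc_interior x.
  by rewrite !inE => xW; rewrite xW.
elim: s f g => [|h s IH] f g fW fg nb.
  move=> /= /and3P[fD gD _]; rewrite (I f) // (I g) //.
  exact: reachable_step fg.
move: nb => /= /and3P[gh _ nb] /andP[fD gD].
by rewrite (I f) //=; apply: IH gh nb gD; apply: reachable_step fg.
Qed.

Lemma puz_acyclic f g s : f \in reachable -> r f g -> nbwalk r f g s ->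
  all [predC branch] (f :: g :: s) -> f \notin g :: s.
Proof.
move=> fW fg nb /(nbwalk_arc fW fg nb) int; apply/negP => fs.
have /and3P[fi gi _] := int.
have [e|e] := arc_step fg fi gi.
  have lt : (blank f : nat) < blank g by rewrite e.
  by have /allP/(_ f fs) := nbwalk_increasing fg nb int e lt; rewrite ltnn.
have lt : (blank g : nat) < blank f by rewrite e.
by have /allP/(_ f fs) := nbwalk_decreasing fg nb int e lt; rewrite ltnn.
Qed.

Lemma branch_reachable : branch \subset reachable.
Proof. by apply/subsetP => f; rewrite inE => /andP[]. Qed.

Lemma puz0_contracted : contracted r reachable branch (puz0 (@theta a b)).
Proof.
split=> //=; first exact: branch_reachable.
case=> f s; apply/imfset2P/idP => /= [[f' f'W [g]]|].
  rewrite !inE /= => /andP[gW fg] [-> ->].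
  by rewrite /segment /= fg -/reachable f'W inE gW.
case: s => [|g s]; rewrite /segment /= ?andbF // => /and3P[fW fg ts].
have gW := reachable_step fW fg; exists f => //; exists g.
  by rewrite inE fg andbT.
by case: s ts => [|h s] //= /andP[]; rewrite gW.
Qed.

Lemma interior_degree f :
  f \in reachable -> f \notin branch -> #|[pred g | r f g]| = 2.
Proof. by move=> fW; rewrite inE fW puz_degree /= => /negbTE->. Qed.

Lemma Ygraph_contracted :
  contracted r reachable branch (Ygraph a b) /\ vert (Ygraph a b) = branch.
Proof.
apply: path_contractionP puz0_contracted.
- exact: puz_sym.
- exact: reachable_step.
- exact: branch_reachable.
- exact: interior_degree.
- by move=> f; rewrite inE puz_degree => /andP[_ ->].
- exact: puz_acyclic.
Qed.

Lemma Ygraph_edge_unique d d' : d \in edge (Ygraph a b) ->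
  d' \in edge (Ygraph a b) -> d.1 = d'.1 -> head d.1 d.2 = head d'.1 d'.2 -> d = d'.
Proof.
have [[DU UW _ _ EY] _] := Ygraph_contracted; rewrite !EY.
exact: (segment_unique puz_sym reachable_step interior_degree DU UW).
Qed.

End ThetaPuzzle.

(** ** Symmetries of the theta graph *)

Section Symmetries.
Variables a b : nat.
Hypothesis a_gt0 : 0 < a.
Notation n := (nlab a b).
Notation position := {perm 'I_n.+1}.
Notation vtx := (@vtx a b).
Notation r := (puz (@theta a b)).
Notation rho := (rho a b).
Notation psi := (psi a b).
Implicit Types (v w : 'I_n.+1) (f g h k : position).

Let nE : n = 2 * a + b + 1. Proof. by []. Qed.

Lemma rhoE v : rho v = (if v <= 2 * a + 1 then
    if v <= a then v + a + 1 else v - (a + 1) else 4 * a + b + 3 - v) :> nat.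
Proof.
rewrite permE /rho_fun; have ltv := ltn_ord v; case: leqP => v1; last first.
  by rewrite vtxE //; lia.
case: leqP => v2.
  by rewrite modn_small ?vtxE //; lia.
have e : v + a + 1 = v - (a + 1) + (2 * a + 2) by lia.
by rewrite e modnDr modn_small ?vtxE; lia.
Qed.

Lemma psiE v : psi v = (if v <= a + 1 then a + 1 - v
    else if v <= 2 * a + 1 then 3 * a + 3 - v else 4 * a + b + 3 - v) :> nat.
Proof.
by rewrite permE /psi_fun; have ltv := ltn_ord v; do 2?case: leqP => ?; rewrite vtxE //; lia.
Qed.

Lemma rhoV : (rho * rho = 1)%g.
Proof.
apply/permP => v; rewrite permM perm1; apply: val_inj => /=.
by have := ltn_ord v; rewrite !rhoE; do ![case: ifP]; lia.
Qed.

Lemma psiV : (psi * psi = 1)%g.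
Proof.
apply/permP => v; rewrite permM perm1; apply: val_inj => /=.
by have := ltn_ord v; rewrite !psiE; do ![case: ifP]; lia.
Qed.

(** The product exchanges the two arcs with [a] interior vertices, and fixes the
    third one pointwise. *)
Lemma rho_psiE v : (rho \c psi) v =
  (if (0 < v) && (v <= 2 * a + 1) then 2 * a + 2 - v else v) :> nat.
Proof.
rewrite /pcomp permM rhoE psiE; have := ltn_ord v.
by do ![case: ifP]; lia.
Qed.

Lemma rho_psiC : rho \c psi = psi \c rho.
Proof.
apply/permP => v; rewrite /pcomp !permM; apply: val_inj => /=.
by have := ltn_ord v; rewrite !rhoE !psiE !rhoE; do ![case: ifP]; lia.
Qed.

Lemma adjn_rho v w : adjn a b v w -> theta (rho v) (rho w).
Proof.
move=> vw; have lev : v <= n by rewrite -ltnS.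
have lew : w <= n by rewrite -ltnS.
suff [|] : adjn a b (rho v) (rho w) \/ adjn a b (rho w) (rho v).
- by rewrite thetaE => ->.
- by rewrite thetaE orbC => ->.
have := rhoE v; have := rhoE w; move: (rho v : nat) (rho w : nat) => x y.
case/adjnP: vw => [[-> ? ?]|[-> ->]|[? -> ->]|[? [[-> ->]|[-> ->]]]];
  rewrite ?leq0n; do ![case: ifP] => *; find_edge.
Qed.

Lemma adjn_psi v w : adjn a b v w -> theta (psi v) (psi w).
Proof.
move=> vw; have lev : v <= n by rewrite -ltnS.
have lew : w <= n by rewrite -ltnS.
suff [|] : adjn a b (psi v) (psi w) \/ adjn a b (psi w) (psi v).
- by rewrite thetaE => ->.
- by rewrite thetaE orbC => ->.
have := psiE v; have := psiE w; move: (psi v : nat) (psi w : nat) => x y.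
case/adjnP: vw => [[-> ? ?]|[-> ->]|[? -> ->]|[? [[-> ->]|[-> ->]]]];
  rewrite ?leq0n; do ![case: ifP] => *; find_edge.
Qed.

(** An involutive automorphism of the graph; it permutes the two hubs. *)
Definition symmetry k : Prop :=
  [/\ (k * k = 1)%g, forall v w, theta v w -> theta (k v) (k w)
    & forall v, hub v -> hub (k v)].

Lemma symmetry_rho : symmetry rho.
Proof.
split; first exact: rhoV.
  by move=> v w; rewrite [in X in X -> _]thetaE => /orP[] /adjn_rho //; rewrite theta_sym.
by move=> v; rewrite !hubE // rhoE; do ![case: ifP]; lia.
Qed.

Lemma symmetry_psi : symmetry psi.
Proof.
split; first exact: psiV.
  by move=> v w; rewrite [in X in X -> _]thetaE => /orP[] /adjn_psi //; rewrite theta_sym.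
by move=> v; rewrite !hubE // psiE; do ![case: ifP]; lia.
Qed.

Lemma symmetryM k k' : k \c k' = k' \c k ->
  symmetry k -> symmetry k' -> symmetry (k \c k').
Proof.
rewrite /pcomp => C [V T H] [V' T' H']; split.
- by rewrite {2}C mulgA -(mulgA k') V mulg1 V'.
- by move=> v w /T' /T; rewrite !permM.
- by move=> v /H' /H; rewrite permM.
Qed.

Lemma symmetry1 : symmetry 1%g.
Proof. by split=> [|v w|v]; rewrite ?mulg1 ?perm1. Qed.

Lemma klein_symmetry k : k \in klein a b -> symmetry k.
Proof.
rewrite !inE -!orbA => /or4P[] /eqP->.
- exact: symmetry1.
- exact: symmetry_rho.
- exact: symmetry_psi.
- by apply: symmetryM; [exact: rho_psiC|exact: symmetry_rho|exact: symmetry_psi].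
Qed.

Lemma blank_act f k : symmetry k -> blank (f \c k) = k (blank f).
Proof.
case=> V _ _; apply/eqP; rewrite eq_sym -blankP /pcomp permM.
rewrite -[k (k _)]permM V perm1.
by rewrite blankP.
Qed.

(** Precomposition with an automorphism moves the blank and its destination by
    the same vertex permutation, which conjugates the transposition. *)
Lemma slide_act f k w : symmetry k -> slide (f \c k) (k w) = slide f w \c k.
Proof.
move=> sk; rewrite /slide blank_act //; case: sk => V _ _; rewrite /pcomp -tpermJ.
have Vk : (k^-1 = k)%g by apply/eqP; rewrite eq_invg_mul V.
by rewrite conjgE Vk -!mulgA (mulgA k k f) V mul1g.
Qed.

Lemma puz_act f g k : symmetry k -> r f g -> r (f \c k) (g \c k).
Proof.
move=> sk /puzP[w fw ->]; apply/puzP; exists (k w); last by rewrite slide_act.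
by rewrite blank_act //; case: sk => _ T _; apply: T.
Qed.

Lemma pcomp_inj k : injective (fun f : position => f \c k).
Proof. by move=> f g; apply: mulgI. Qed.

Lemma reachable_act f k : symmetry k -> k \in reachable a b ->
  f \in reachable a b -> f \c k \in reachable a b.
Proof.
have e1 : 1%g \c k = k := mulg1 k.
move=> sk; rewrite !inE => k1 /connectP[p pp ->]; apply: connect_trans k1 _.
apply/connectP; exists [seq g \c k | g <- p]; last first.
  by rewrite -[X in _ = last X _]e1 (last_map (fun g : position => g \c k)).
rewrite -[X in path _ X _]e1 (path_map (f := fun g : position => g \c k)).
by apply: sub_path pp => g h; apply: puz_act.
Qed.

Lemma branch_act f k : symmetry k -> k \in reachable a b ->
  f \in branch a b -> f \c k \in branch a b.
Proof.
move=> sk kW; rewrite [_ \in branch a b]inE => /andP[fW hf].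
rewrite inE reachable_act // blank_act //; by case: sk => _ _; apply.
Qed.

Lemma act_invol f k : symmetry k -> (f \c k) \c k = f.
Proof. by case=> V _ _; rewrite /pcomp mulgA V mul1g. Qed.

Lemma branch_actE f k : symmetry k -> k \in reachable a b ->
  (f \c k \in branch a b) = (f \in branch a b).
Proof.
move=> sk kW; apply/idP/idP; last exact: branch_act.
by move/(branch_act sk kW); rewrite act_invol.
Qed.

Lemma segment_act k d : symmetry k -> k \in reachable a b ->
  segment r (branch a b) d -> segment r (branch a b) (act_walk d k).
Proof.
move=> sk kW; case: d => f [|g s]; rewrite /segment /= ?andbF //.
rewrite /act_position branch_actE // => /and3P[-> fg ts]; rewrite puz_act //=.
elim: s f g {fg} ts => [|h s IH] f g /=; first by rewrite branch_actE.
move=> /and4P[gD gh hf ts]; rewrite branch_actE // gD puz_act // IH // andbT.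
by apply: contra hf => /eqP/pcomp_inj ->.
Qed.

Lemma klein_group_set : group_set (klein a b).
Proof.
have C : (psi * rho = rho * psi)%g by exact: rho_psiC.
have RV x : (rho * (rho * x) = x)%g by rewrite mulgA rhoV mul1g.
have PV x : (psi * (psi * x) = x)%g by rewrite mulgA psiV mul1g.
have C' x : (psi * (rho * x) = rho * (psi * x))%g by rewrite mulgA C mulgA.
apply/group_setP; split; first by rewrite !inE eqxx.
move=> x y; rewrite !inE /pcomp C -!orbA.
by move=> /or4P[] /eqP-> /or4P[] /eqP->; rewrite ?mulg1 ?mul1g -?mulgA ?C ?C' ?rhoV
  ?psiV ?RV ?PV ?rhoV ?psiV ?mulg1 ?eqxx ?orbT.
Qed.

Lemma rho_hub : rho (vtx 0) = vtx (a + 1).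
Proof. by apply: ord_inj; rewrite rhoE !vtxE ?leq0n; lia. Qed.

Lemma rho_hub' : rho (vtx (a + 1)) = vtx 0.
Proof. by apply: ord_inj; rewrite rhoE !vtxE; try lia; do ![case: ifP]; lia. Qed.

Lemma psi_hub : psi (vtx 0) = vtx (a + 1).
Proof. by apply: ord_inj; rewrite psiE !vtxE ?leq0n; lia. Qed.

Lemma psi_hub' : psi (vtx (a + 1)) = vtx 0.
Proof. by apply: ord_inj; rewrite psiE !vtxE; try lia; do ![case: ifP]; lia. Qed.

Lemma rho_psi_hub : (rho \c psi) (vtx 0) = vtx 0.
Proof. by rewrite /pcomp permM psi_hub rho_hub'. Qed.

Lemma rho_psi_neq1 : rho \c psi != 1%g.
Proof.
apply/eqP => /permP/(_ (vtx 1)) /(congr1 (@nat_of_ord _)).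
by rewrite rho_psiE perm1 vtxE //; [case: ifP|]; lia.
Qed.

Lemma hubs_neq : vtx 0 != vtx (a + 1).
Proof. by rewrite -val_eqE /= !vtxE //; lia. Qed.

End Symmetries.

(** ** The edges of the contracted puzzle graph *)

Section Arcs.
Variables a b : nat.
Hypothesis a_gt0 : 0 < a.
Notation n := (nlab a b).
Notation position := {perm 'I_n.+1}.
Notation vtx := (@vtx a b).
Notation r := (puz (@theta a b)).
Notation hubs := [set v : 'I_n.+1 | hub v].
Notation path1 := (path1 a b).
Notation path2 := (path2 a b).
Notation path3 := (path3 a b).
Notation arcs := [:: path1; path2; path3].
Implicit Types (v w : 'I_n.+1) (f g h k : position) (p : seq 'I_n.+1).

Let nE : n = 2 * a + b + 1. Proof. by []. Qed.

Fixpoint slides f p : seq position :=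
  if p is w :: p' then slide f w :: slides (slide f w) p' else [::].

Lemma last_slides f p : last f (slides f p) = f \c sigma_path (blank f) p.
Proof.
elim: p f => [|w p IH] f /=; first by rewrite /pcomp mul1g.
by rewrite IH blank_slide /slide /pcomp !mulgA.
Qed.

Lemma blank_slides f p : blank (last f (slides f p)) = last (blank f) p.
Proof. by elim: p f => [|w p IH] f //=; rewrite IH blank_slide. Qed.

Lemma uniq_tail (T : finType) (e : rel T) (U : {set T}) q x s : uniq (q :: x :: s) ->
  path e x s -> all [predC U] (belast x s) -> last x s \in U -> tail e U q x s.
Proof.
elim: s q x => [|y s IH] q x //=.
rewrite !inE !negb_or -!andbA => /and3P[_ qy /and4P[qs xy xs us]].
move=> /andP[-> ys] /andP[-> sU] lU /=; rewrite eq_sym qy /=; apply: IH => //=.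
by rewrite inE negb_or xy xs.
Qed.

Lemma slides_tail f g p : g \in reachable a b -> r g f ->
  tail (@theta a b) hubs (blank g) (blank f) p ->
  tail r (branch a b) g f (slides f p).
Proof.
elim: p f g => [|w p IH] f g gW gf /=.
  by rewrite !inE => ->; rewrite andbT; have := reachable_step gW gf; rewrite inE.
rewrite !inE => /and4P[nh fw wg ts].
have fW := reachable_step gW gf.
have fs : r f (slide f w) by apply/puzP; exists w.
rewrite negb_and nh orbT fs IH ?blank_slide //= andbT.
by apply: contra wg => /eqP <-; rewrite blank_slide.
Qed.

(** A description common to the three arcs: [P] lists the indices of the [l.+1]
    vertices of the path that starts at the first hub and continues with [p]. *)
Definition arc_points (l : nat) (P : nat -> nat) p : Prop :=
  [/\ P 0 = 0 /\ P l = a + 1, forall i, i <= l -> P i <= n,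
      {in [pred i | i <= l] &, injective P},
      forall i, i < l -> theta (vtx (P i)) (vtx (P i.+1))
    & p = [seq vtx (P i) | i <- iota 1 l]] /\ 0 < l.

Definition point2 i := if i == 0 then 0 else if i == b + 1 then a + 1 else 2 * a + 1 + i.
Definition point3 i := if i == 0 then 0 else 2 * a + 2 - i.

Lemma arc_points1 : arc_points a.+1 id path1.
Proof.
split=> //; split=> //; first by rewrite addn1.
- by move=> i; lia.
- move=> i lt; rewrite thetaE !vtxE; try lia.
  by apply/orP; left; apply/(adjnP a b); constructor 1; split; lia.
- by rewrite /Defs.path1 addn1.
Qed.

Lemma arc_points2 : arc_points b.+1 point2 path2.
Proof.
split=> //; split=> //.
- by rewrite /point2 /= (addn1 b) eqxx.
- by move=> i; rewrite /point2; do ![case: ifP]; lia.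
- by move=> i j; rewrite !inE /point2; do ![case: eqP]; lia.
- move=> i lt.
  have p0 : point2 i = if i == 0 then 0 else 2 * a + 1 + i.
    by rewrite /point2; do ![case: ifP]; lia.
  have p1 : point2 i.+1 = if i == b then a + 1 else 2 * a + 2 + i.
    by rewrite /point2 /=; do ![case: ifP]; lia.
  rewrite thetaE p0 p1; case: eqP => i0; case: eqP => i1; rewrite !vtxE; try lia;
    apply/orP; left; apply/(adjnP a b).
  + by constructor 3; split; lia.
  + by constructor 4; split; [|left]; lia.
  + by constructor 4; split; [|right]; lia.
  + by constructor 1; split; lia.
- rewrite /Defs.path2; apply: (@eq_from_nth _ ord0).
    by rewrite !size_map size_rcons !size_iota.
  move=> i; rewrite size_map size_rcons size_iota => lt.
  rewrite (nth_map 0) ?size_rcons ?size_iota // (nth_map 0) ?size_iota //=.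
  rewrite nth_rcons size_iota (@nth_iota _ 1 b.+1) // add1n /point2 /=.
  have -> : (i.+1 == b + 1) = (i == b) by lia.
  case: ltnP => ib; last by have -> : i = b by [lia]; rewrite eqxx.
  by rewrite nth_iota // ifN; [congr (vtx _)|]; lia.
Qed.

Lemma arc_points3 : arc_points a.+1 point3 path3.
Proof.
split=> //; split=> //.
- by rewrite /point3 /=; split=> //; lia.
- by move=> i; rewrite /point3; case: ifP; lia.
- by move=> i j; rewrite !inE /point3; do ![case: eqP]; lia.
- move=> i lt; rewrite thetaE !vtxE; try by rewrite /point3 /=; try case: ifP; lia.
  rewrite /point3 /=; case: eqP => [->|i0]; apply/orP.
    by left; apply/(adjnP a b); constructor 2; split; lia.
  by right; apply/(adjnP a b); constructor 1; split; lia.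
- rewrite /Defs.path3; apply: (@eq_from_nth _ ord0).
    by rewrite !size_map size_rev !size_iota addn1.
  move=> i; rewrite size_map size_rev size_iota => lt.
  rewrite (nth_map 0) ?size_rev ?size_iota // (nth_map 0) ?size_iota; last by lia.
  rewrite nth_rev ?size_iota // !nth_iota; try lia.
  by rewrite /= /point3 add1n /=; congr (vtx _); lia.
Qed.

Lemma arcsP p : p \in arcs -> exists l P, arc_points l P p.
Proof.
rewrite !inE => /or3P[] /eqP->.
- by exists a.+1, id; apply: arc_points1.
- by exists b.+1, point2; apply: arc_points2.
- by exists a.+1, point3; apply: arc_points3.
Qed.

Section OneArc.
Variables (l : nat) (P : nat -> nat) (p : seq 'I_n.+1).
Hypothesis Pp : arc_points l P p.

Lemma arc_cons : vtx 0 :: p = [seq vtx (P i) | i <- iota 0 l.+1].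
Proof. by have [[[e0 _] _ _ _ ->] l0] := Pp; rewrite /= e0. Qed.

Lemma arc_uniq : uniq (vtx 0 :: p).
Proof.
rewrite arc_cons; have [[_ Pn Pinj _ _] l0] := Pp.
rewrite map_inj_in_uniq ?iota_uniq // => i j.
rewrite !mem_iota !add0n !ltnS => il jl /(congr1 val) /=.
by rewrite !vtxE ?Pn //; apply: Pinj.
Qed.

Lemma arc_size : size p = l.
Proof. by have [[_ _ _ _ ->] _] := Pp; rewrite size_map size_iota. Qed.

Lemma arc_nth i : i <= l -> nth (vtx 0) (vtx 0 :: p) i = vtx (P i).
Proof. by move=> le; rewrite arc_cons (nth_map 0) ?size_iota // nth_iota. Qed.

Lemma arc_path : path (@theta a b) (vtx 0) p.
Proof.
apply/(pathP (vtx 0)) => i; rewrite arc_size => lt.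
rewrite -[nth _ p i]/(nth (vtx 0) (vtx 0 :: p) i.+1) !arc_nth //; last exact: ltnW.
by have [[_ _ _ th _] _] := Pp; apply: th.
Qed.

Lemma arc_last : last (vtx 0) p = vtx (a + 1).
Proof.
have [[[_ el] _ _ _ _] _] := Pp.
by rewrite (last_nth (vtx 0)) arc_size arc_nth // el.
Qed.

Lemma arc_segment : segment (@theta a b) hubs (vtx 0, p).
Proof.
have := arc_uniq; have := arc_path; have := arc_last.
case: p => [/(congr1 val)|x q] /=; first by rewrite /= !vtxE; lia.
move=> lq /andP[vx xq] uq; have := uq.
rewrite -[_ && _]/(uniq (vtx 0 :: x :: q)) lastI rcons_uniq /= lq => /andP[naq _].
rewrite /segment /= inE {1}/hub eqxx vx /=; apply: uniq_tail => //; last first.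
  by rewrite lq inE /hub eqxx orbT.
apply/allP => v vq; rewrite !inE negb_or; apply/andP; split.
  apply: contraTneq uq => <-; rewrite lastI mem_rcons inE.
  by rewrite vq orbT.
by apply: contraNneq naq => <-; rewrite inE vq orbT.
Qed.

End OneArc.

(** The three lemmas below say that the product of the transpositions along a
    path is the cycle that follows the path and returns to its origin. *)
Lemma sigma_path_out w p v : v \notin w :: p -> sigma_path w p v = v.
Proof.
elim: p w => [|w' p IH] w; first by rewrite perm1.
rewrite inE negb_or => /andP[vw vp]; rewrite /= /pcomp permM IH //.
by apply: tpermD; [rewrite eq_sym | apply: contraNneq vp => <-; rewrite mem_head].
Qed.

Lemma sigma_path_last w p : sigma_path w p (last w p) = w.
Proof.
by elim: p w => [|w' p IH] w; rewrite ?perm1 //= /pcomp permM IH tpermR.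
Qed.

Lemma sigma_path_nth w p i : uniq (w :: p) -> i < size p ->
  sigma_path w p (nth w (w :: p) i) = nth w p i.
Proof.
elim: p w i => [|w' p IH] w [|i] //= /and3P[wp w'p up] lt.
  by rewrite /pcomp permM sigma_path_out // tpermL.
have ltp : i < size (w' :: p) by apply: ltnW.
rewrite /pcomp permM (set_nth_default w') // IH ?(set_nth_default w _ lt) //=.
  rewrite tpermD //.
    by apply: contraNneq wp => ->; rewrite inE mem_nth ?orbT.
  by apply: contraNneq w'p => ->; rewrite mem_nth.
by rewrite w'p up.
Qed.

Lemma sigma_arc l P p i : arc_points l P p -> i <= l ->
  sigma_path (vtx 0) p (vtx (P i)) = vtx (P (if i == l then 0 else i.+1)).
Proof.
move=> Pp le; have [[[e0 el] _ _ _ _] l0] := Pp.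
have [->|ne] := eqVneq i l; first by rewrite e0 el -(arc_last Pp) sigma_path_last.
have lt : i < l by rewrite ltn_neqAle ne.
rewrite -(arc_nth Pp le) sigma_path_nth ?(arc_uniq Pp) ?(arc_size Pp) //.
by rewrite -[nth _ p i]/(nth (vtx 0) (vtx 0 :: p) i.+1) (arc_nth Pp).
Qed.

Lemma sigma_arc_inj p q : p \in arcs -> q \in arcs ->
  sigma_path (vtx 0) p = sigma_path (vtx 0) q -> p = q.
Proof.
have s1 : sigma_path (vtx 0) path1 (vtx 0) = 1 :> nat.
  have -> : sigma_path (vtx 0) path1 (vtx 0) = vtx 1 := sigma_arc arc_points1 (leq0n _).
  by rewrite vtxE; lia.
have s2 : sigma_path (vtx 0) path2 (vtx 0) = point2 1 :> nat.
  have -> : sigma_path (vtx 0) path2 (vtx 0) = vtx (point2 1)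
    := sigma_arc arc_points2 (leq0n _).
  by rewrite vtxE // /point2; do ![case: ifP]; lia.
have s3 : sigma_path (vtx 0) path3 (vtx 0) = 2 * a + 1 :> nat.
  have -> : sigma_path (vtx 0) path3 (vtx 0) = vtx (point3 1)
    := sigma_arc arc_points3 (leq0n _).
  by rewrite vtxE // /point3 /=; lia.
have p2 : point2 1 = a + 1 \/ point2 1 = 2 * a + 2.
  by rewrite /point2; do ![case: ifP]; lia.
rewrite !inE => /or3P[] /eqP-> /or3P[] /eqP-> // /(congr1
  (fun s : position => s (vtx 0) : nat)); rewrite ?s1 ?s2 ?s3; lia.
Qed.

Lemma odd_sigma_path w p : uniq (w :: p) -> odd_perm (sigma_path w p) = odd (size p).
Proof.
elim: p w => [|w' p IH] w; first by rewrite odd_perm1.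
rewrite [uniq _]/= inE negb_or -andbA => /and3P[ww' _ up].
by rewrite /= /pcomp odd_permM odd_tperm ww' IH // addbT.
Qed.

(** ** Edges at a position whose blank is at the first hub *)

Lemma arc_edge f p : f \in branch a b -> blank f = vtx 0 -> p \in arcs ->
  (f, slides f p) \in edge (Ygraph a b).
Proof.
move=> fD bf /arcsP[l [P Pp]].
have [[_ _ _ _ ->] ->] := Ygraph_contracted b a_gt0.
have := arc_segment Pp; rewrite /segment fD; case: p Pp => [|w p] Pp //=.
  by rewrite andbF.
move=> /and3P[_ vw tw]; have fw : r f (slide f w) by apply/puzP; exists w; rewrite ?bf.
rewrite fw /=; apply: slides_tail => //; last by rewrite blank_slide bf.
by move: fD; rewrite inE => /andP[].
Qed.

(** The edges of the theta graph at the first hub are the first edges of the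
    three arcs, and an edge of the contracted graph is determined by its first
    step. *)
Lemma edge_arc d : d \in edge (Ygraph a b) -> blank (wsrc d) = vtx 0 ->
  exists2 p, p \in arcs & d = (wsrc d, slides (wsrc d) p).
Proof.
move=> dY bd; have [[_ _ _ _ EY] VY] := Ygraph_contracted b a_gt0.
have := dY; rewrite EY VY => dS.
have fD : wsrc d \in branch a b by case/andP: dS.
have [p pa hp] : exists2 p, p \in arcs & head (vtx 0) p = blank (head (wsrc d) d.2).
  case: d dS bd {dY fD} => f [|g s]; rewrite /segment /= ?andbF // /wsrc /=.
  case/and3P=> _ + _ bf; rewrite puzE bf => /andP[th _].
  have ltg := ltn_ord (blank g).
  have [[_ _ _ _ e1] _] := arc_points1; have [[_ _ _ _ e2] _] := arc_points2.
  have [[_ _ _ _ e3] _] := arc_points3.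
  suff : [\/ blank g = 1 :> nat, blank g = point2 1 :> nat
          | blank g = point3 1 :> nat].
    case=> e; rewrite -[blank g]vtx_id e; [exists path1|exists path2|exists path3];
      by rewrite ?inE ?eqxx ?orbT // ?e1 ?e2 ?e3.
  move: th; rewrite thetaE vtxE // => /orP[] /(adjnP a b);
    rewrite /point2 /point3 /=.
  + case=> [[e *]|[_ e]|[b0 _ e]|[b0 [[_ e]|[*]]]]; [constructor 1|constructor 3|
      constructor 2|constructor 2|]; rewrite ?e ?b0 //; try case: ifP; lia.
  + by case=> [[e *]|[e e']|[b0 _ e]|[b0 [[_ e]|[*]]]]; lia.
exists p => //; have pS := arc_edge fD bd pa.
apply: (Ygraph_edge_unique a_gt0 dY pS) => //=.
case: d dS {pS fD} bd hp dY => f [|g s]; rewrite /segment /= ?andbF // /wsrc /=.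
case/and3P=> _ fg _ _ hp _; move: fg; rewrite puzE -hp => /andP[_ /eqP->].
have [l [P Pp]] := arcsP pa; have := arc_size Pp; have [_] := Pp.
by case: p {pa Pp hp} => [|w p] /=; move=> /[swap] <-.
Qed.

End Arcs.

(** * Groups of permutations generated by 3-cycles *)

Section ThreeCycles.
Variables (T : finType) (H : {group {perm T}}).
Implicit Types (x y z u w : T) (s : {perm T}).
Local Open Scope group_scope.

(** The cycle [x -> y -> z -> x]. *)
Definition cyc3 x y z : {perm T} := tperm x y * tperm x z.

Lemma cyc3J s x y z : cyc3 x y z ^ s = cyc3 (s x) (s y) (s z).
Proof. by rewrite /cyc3 conjMg !tpermJ. Qed.

Lemma cyc3V x y z : (cyc3 x y z)^-1 = cyc3 x z y.
Proof. by rewrite /cyc3 invMg !tpermV. Qed.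

Lemma cyc3_rot x y z : uniq [:: x; y; z] -> cyc3 x y z = cyc3 y z x.
Proof.
rewrite /= !inE negb_or => /andP[/andP[xy xz] /andP[yz _]].
rewrite /cyc3 [tperm y x]tpermC [RHS]conjgC tpermJ tpermR tpermD //.
Qed.

Lemma cyc3_1 x y z : uniq [:: x; y; z] -> cyc3 x y z x = y.
Proof.
rewrite /= !inE negb_or => /andP[/andP[xy xz] /andP[yz _]].
by rewrite /cyc3 permM tpermL tpermD // eq_sym.
Qed.

Lemma uniq3_rot x y z : uniq [:: x; y; z] = uniq [:: y; z; x].
Proof. by rewrite -(rot_uniq 1). Qed.

Lemma uniq3_swap x y z : uniq [:: x; y; z] = uniq [:: x; z; y].
Proof. by rewrite /= !inE !negb_or [z == y]eq_sym; do 3!case: (_ == _). Qed.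

Lemma cyc3_2 x y z : uniq [:: x; y; z] -> cyc3 x y z y = z.
Proof.
by move=> u; rewrite cyc3_rot // cyc3_1 // -uniq3_rot.
Qed.

Lemma cyc3_out x y z u : u \notin [:: x; y; z] -> cyc3 x y z u = u.
Proof.
rewrite !inE !negb_or => /and3P[ux uy uz].
by rewrite /cyc3 permM !tpermD // eq_sym.
Qed.

(** The classes of this relation are blocks of the group, by the next lemmas; it
    suffices to find one class in order to have all the 3-cycles. *)
Definition linked x y : bool :=
  (x == y) || [exists z, uniq [:: x; y; z] && (cyc3 x y z \in H)].

Lemma cyc3_linked x y z : cyc3 x y z \in H -> uniq [:: x; y; z] -> linked x y.
Proof. by move=> h u; apply/orP; right; apply/existsP; exists z; rewrite u. Qed.

Lemma linked_refl x : linked x x. Proof. by rewrite /linked eqxx. Qed.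

Lemma linked_sym x y : linked x y -> linked y x.
Proof.
case/orP=> [/eqP->|/existsP[z /andP[u h]]]; first exact: linked_refl.
apply: (@cyc3_linked _ _ z); last by rewrite uniq3_swap -uniq3_rot.
by rewrite -groupV cyc3V -cyc3_rot.
Qed.

Lemma linkedJ s x y : s \in H -> linked x y -> linked (s x) (s y).
Proof.
move=> sH /orP[/eqP->|/existsP[z /andP[u h]]]; first exact: linked_refl.
apply: (@cyc3_linked _ _ (s z)); first by rewrite -cyc3J groupJ.
by rewrite -[[:: s x; _; _]]/(map s [:: x; y; z]) map_inj_uniq //; apply: perm_inj.
Qed.

(** With 3-cycles through [x, y] and through [y, w], the conjugate of the second
    by a power of the first that sends [y] to [x] and fixes [w] passes through
    [x, w]; if the first does not fix [w], it contains [x] and [w] already. *)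
Lemma linked_trans x y w : linked x y -> linked y w -> linked x w.
Proof.
move=> xy yw; case/orP: (xy) => [/eqP->//|/existsP[z /andP[u h]]].
have [win|wout] := boolP (w \in [:: x; y; z]).
  move: win; rewrite !inE => /or3P[] /eqP-> //; first exact: linked_refl.
  apply: linked_sym; apply: (@cyc3_linked _ _ y); last by rewrite uniq3_rot.
  by rewrite cyc3_rot // uniq3_rot.
have := linkedJ (groupVr h) yw.
have -> : (cyc3 x y z)^-1 y = x by apply/(canLR (permK _)); rewrite cyc3_1.
by have -> : (cyc3 x y z)^-1 w = w by apply/(canLR (permK _)); rewrite cyc3_out.
Qed.

(** The third point [z] of a 3-cycle through [x, y] is linked to [w]: a 3-cycle
    through [z, w], in one of its directions, conjugates the first one to a
    3-cycle on [x, y, w]. *)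
Lemma linked_cyc3 x y w : linked x y -> linked y w -> uniq [:: x; y; w] ->
  cyc3 x y w \in H.
Proof.
move=> xy yw u3; move: (u3); rewrite /= !inE negb_or => /andP[/andP[nxy nxw] /andP[nyw _]].
case/orP: (xy) => [/eqP e|/existsP[z /andP[u h]]]; first by rewrite e eqxx in nxy.
have [<-//|nzw] := eqVneq z w.
have zx : linked z x.
  by apply: (@cyc3_linked _ _ y); rewrite 1?cyc3_rot // uniq3_rot.
have : linked z w := linked_trans zx (linked_trans xy yw).
case/orP=> [/eqP e|/existsP[v /andP[uv hv]]]; first by rewrite e eqxx in nzw.
have d3 p q t : [&& p != q, p != t & q != t] -> uniq [:: p; q; t].
  by move=> /and3P[pq pt qt]; rewrite /= !inE negb_or pq pt qt.
move: (uv) (u); rewrite /= !inE !negb_or !andbT.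
move=> /andP[/andP[_ nzv] nwv] /andP[/andP[_ nxz] nyz].
have hV : cyc3 z v w \in H by rewrite -cyc3V groupV.
have uV : uniq [:: z; v; w] by apply: d3; rewrite nzv nzw eq_sym nwv.
have [evx|nvx] := eqVneq v x.
  subst v; have := groupJ h hV; rewrite cyc3J cyc3_1 // cyc3_2 //.
  rewrite cyc3_out; last by rewrite !inE !negb_or nyz nyw eq_sym nxy.
  have u3' : uniq [:: y; w; x] by rewrite -uniq3_rot.
  by rewrite -groupV cyc3V (cyc3_rot u3) (cyc3_rot u3').
have [evy|nvy] := eqVneq v y.
  subst v; have := groupJ h hV; rewrite cyc3J cyc3_1 // cyc3_2 //.
  rewrite cyc3_out; last by rewrite !inE !negb_or nxz nxw nxy.
  by rewrite -groupV cyc3V.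
have := groupJ h hv; rewrite cyc3J cyc3_1 // !cyc3_out //.
- by rewrite !inE !negb_or nyz nyw eq_sym nvy.
- by rewrite !inE !negb_or nxz nxw eq_sym nvx.
Qed.

(** Two disjoint transpositions differ by two 3-cycles through a transposition
    that meets both. *)
Lemma tpermM_mem x y z w : (forall x y z, uniq [:: x; y; z] -> cyc3 x y z \in H) ->
  x != y -> z != w -> tperm x y * tperm z w \in H.
Proof.
move=> H3.
have share p q t : p != q -> p != t -> tperm p q * tperm p t \in H.
  move=> pq pt; have [->|qt] := eqVneq q t; first by rewrite tperm2 group1.
  by apply: H3; rewrite /= !inE negb_or pq pt qt.
move=> xy zw.
have [ezx|nzx] := eqVneq z x; first by subst z; apply: share.
have [ewx|nwx] := eqVneq w x.
  by rewrite ewx [tperm z x]tpermC; apply: share => //; rewrite eq_sym.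
have -> : tperm x y * tperm z w = (tperm x y * tperm x z) * (tperm z x * tperm z w).
  by rewrite [tperm z x]tpermC mulgA -(mulgA _ _ (tperm x z)) tperm2 mulg1.
by rewrite groupM ?share // eq_sym.
Qed.

Lemma Alt_sub_of_cyc3 :
  (forall x y z, uniq [:: x; y; z] -> cyc3 x y z \in H) ->
  forall s, ~~ odd_perm s -> s \in H.
Proof.
move=> H3 s; case: (prod_tpermP s) => ts -> dts; rewrite odd_perm_prod //.
have [m] := ubnP (size ts); elim: m ts dts => // m IH [|t [|t' ts]] //=.
  by rewrite big_nil group1.
move=> /and3P[dt dt' dts] lt; rewrite negbK => ev.
rewrite !big_cons mulgA groupM ?tpermM_mem ?IH //.
exact: ltnW lt.
Qed.

Lemma tperm_commute x y z t : x \notin [:: z; t] -> y \notin [:: z; t] ->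
  commute (tperm x y) (tperm z t).
Proof.
rewrite !inE !negb_or => /andP[xz xt] /andP[yz yt].
by rewrite /commute conjgC tpermJ !tpermD // eq_sym.
Qed.

(** Two double transpositions that meet in a single point have a product of
    order six, whose square is a 3-cycle. *)
Lemma double_tperm_square x y z u v w t : uniq [:: x; y; z; u; v; w; t] ->
  ((tperm x y * tperm z t) * (tperm u v * tperm w t)) ^+ 2 = cyc3 w z t.
Proof.
rewrite /= !inE !negb_or -!andbA; repeat (case/andP; move=> ?); move=> _.
have AC : commute (tperm x y) (tperm u v).
  by apply: tperm_commute; rewrite !inE negb_or; apply/andP.
have AD : commute (tperm x y) (tperm w t).
  by apply: tperm_commute; rewrite !inE negb_or; apply/andP.
have CB : commute (tperm u v) (tperm z t).
  by apply: commute_sym; apply: tperm_commute; rewrite !inE negb_or; apply/andP; split;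
     rewrite // eq_sym.
have CD : commute (tperm u v) (tperm w t).
  by apply: tperm_commute; rewrite !inE negb_or; apply/andP; split; rewrite // eq_sym.
have AB : commute (tperm x y) (tperm z t).
  by apply: tperm_commute; rewrite !inE negb_or; apply/andP.
rewrite mulgA -(mulgA (tperm x y)) -CB mulgA -(mulgA _ (tperm z t)).
rewrite expgMn; last first.
  by apply: commuteM; apply: commute_sym; apply: commuteM; apply: commute_sym.
rewrite expgMn // !expgS expg0 !mulg1 !tperm2 !mul1g.
rewrite mulgA -(mulgA (tperm z t)) [(tperm w t * tperm z t)%g]conjgC mulgA tperm2 mul1g.
by rewrite tpermJ tpermR tpermD // eq_sym.
Qed.

End ThreeCycles.

(** * The permutations realised by closed walks of the blank *)

Section Wilson.
Variables a b : nat.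
Hypothesis a_gt0 : 0 < a.
Notation n := (nlab a b).
Notation position := {perm 'I_n.+1}.
Notation vtx := (@vtx a b).
Notation r := (puz (@theta a b)).
Notation path1 := (path1 a b).
Notation path2 := (path2 a b).
Notation path3 := (path3 a b).
Notation arcs := [:: path1; path2; path3].
Implicit Types (v w : 'I_n.+1) (f g h k : position) (p : seq 'I_n.+1).

Let nE : n = 2 * a + b + 1. Proof. by []. Qed.

Definition stable_positions : {set position} :=
  [set f in reachable a b | f ord0 == ord0].

Lemma blank_stable f : f ord0 = ord0 -> blank f = vtx 0.
Proof. by move=> f0; rewrite vtx0; apply/eqP; rewrite eq_sym -blankP f0. Qed.

Lemma puz_relabel h f g : h ord0 = ord0 -> r f g -> r (h \c f) (h \c g).
Proof.
move=> h0 /puzP[w fw ->].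
have bh : blank (h \c f) = blank f.
  by apply/eqP; rewrite eq_sym -blankP /pcomp permM /blank permKV h0.
by apply/puzP; exists w; rewrite ?bh // /slide bh /pcomp mulgA.
Qed.

(** Relabelling the tiles of a move sequence by a stable position composes the
    two permutations. *)
Lemma stable_group_set : group_set stable_positions.
Proof.
apply/group_setP; split; first by rewrite !inE perm1 connect0 eqxx.
move=> f g; rewrite !inE => /andP[f1 /eqP f0] /andP[g1 /eqP g0].
rewrite permM f0 g0 eqxx andbT; apply: connect_trans g1 _.
have e1 : g \c 1%g = g := mul1g g.
case/connectP: f1 => s ps ->; apply/connectP; exists [seq g \c h | h <- s].
  rewrite -[X in path _ X _]e1 (path_map (f := fun h : position => g \c h)).
  by apply: sub_path ps => x y; apply: puz_relabel.
by rewrite -[X in _ = last X _]e1 (last_map (fun h : position => g \c h)).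
Qed.
Canonical stable_group := Group stable_group_set.

Lemma reachable_slidesE f p : path (@theta a b) (blank f) p ->
  (last f (slides f p) \in reachable a b) = (f \in reachable a b).
Proof.
elim: p f => [|w p IH] f //= /andP[fw wp]; rewrite IH ?blank_slide //.
have fs : r f (slide f w) by apply/puzP; exists w.
by apply/idP/idP => [sW|fW]; apply: reachable_step; first [exact: sW | exact: fW
  | rewrite // puz_sym].
Qed.

Lemma reachable_sigma f p : p \in arcs -> f ord0 = ord0 ->
  (f \c sigma_path (vtx 0) p \in reachable a b) = (f \in reachable a b).
Proof.
move=> /(arcsP a_gt0)[l [P Pp]] f0; rewrite -(blank_stable f0) -last_slides.
by rewrite reachable_slidesE // (blank_stable f0) (arc_path Pp).
Qed.

Lemma reachable1 : 1%g \in reachable a b.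
Proof. by rewrite inE connect0. Qed.

Lemma sigma_arc_hubs p : p \in arcs ->
  sigma_path (vtx 0) p (vtx (a + 1)) = ord0.
Proof.
move=> /(arcsP a_gt0)[l [P Pp]].
by rewrite -(arc_last Pp) sigma_path_last vtx0.
Qed.

(** The blank goes along the arc [p] and returns along the arc [q]. *)
Definition loop p q : position := sigma_path (vtx 0) p \c (sigma_path (vtx 0) q)^-1.

Lemma loopE p q v : loop p q (sigma_path (vtx 0) q v) = sigma_path (vtx 0) p v.
Proof. by rewrite /loop /pcomp permM permK. Qed.

Lemma loop_stable p q : p \in arcs -> q \in arcs -> loop p q \in stable_positions.
Proof.
move=> pa qa; have l0 : loop p q ord0 = ord0.
  by rewrite -{1}(sigma_arc_hubs qa) loopE sigma_arc_hubs.
rewrite inE l0 eqxx andbT -(reachable_sigma qa l0) /loop /pcomp mulKVg.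
have e1 : 1%g \c sigma_path (vtx 0) p = sigma_path (vtx 0) p := mulg1 _.
by rewrite -e1 reachable_sigma ?reachable1 ?perm1.
Qed.

Let in_arc l P p v : arc_points l P p ->
  (exists2 i, i <= l & v = vtx (P i)) \/
  v \notin vtx 0 :: p /\ forall i, i <= l -> (v : nat) <> P i.
Proof.
move=> Pp; have [vin|vn] := boolP (v \in vtx 0 :: p); [left; move: vin|right].
  rewrite (arc_cons Pp) => /mapP[i]; rewrite mem_iota => /andP[_ lt] ->.
  by exists i.
split=> // i le e; case/negP: vn; rewrite (arc_cons Pp); apply/mapP; exists i.
  by rewrite mem_iota.
by rewrite -e vtx_id.
Qed.

Let sigma1 v : [\/ v <= a /\ sigma_path (vtx 0) path1 v = v.+1 :> nat,
  v = a + 1 :> nat /\ sigma_path (vtx 0) path1 v = 0 :> nat |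
  a + 1 < v /\ sigma_path (vtx 0) path1 v = v :> nat].
Proof.
have Pp := arc_points1 b a_gt0; have [[i le ->]|[vn vP]] := in_arc v Pp.
  rewrite (sigma_arc Pp le); case: eqP => [->|ne]; rewrite !vtxE //=; try lia.
    by constructor 2; rewrite ?addn1.
  by constructor 1; split=> //; lia.
constructor 3; rewrite (sigma_path_out vn); split=> //.
by rewrite ltnNge; apply/negP => le; apply: (vP v) => //; lia.
Qed.

Let sigma2 v : [\/
  v = 0 :> nat /\
    (b = 0 /\ sigma_path (vtx 0) path2 v = a + 1 :> nat \/
     0 < b /\ sigma_path (vtx 0) path2 v = 2 * a + 2 :> nat),
  v = a + 1 :> nat /\ sigma_path (vtx 0) path2 v = 0 :> nat,
  [/\ 0 < v, v <= 2 * a + 1, v <> a + 1 :> nat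
    & sigma_path (vtx 0) path2 v = v :> nat] |
  2 * a + 2 <= v /\
    (v = n :> nat /\ sigma_path (vtx 0) path2 v = a + 1 :> nat \/
     v < n /\ sigma_path (vtx 0) path2 v = v.+1 :> nat)].
Proof.
have Pp := arc_points2 b a_gt0; have [[i le ->]|[vn vP]] := in_arc v Pp.
  have ->: sigma_path (vtx 0) path2 (vtx (point2 a b i)) =
           vtx (point2 a b (if i == b.+1 then 0 else i.+1)) by apply: sigma_arc.
  have [[[_ _] Pn _ _ _] _] := Pp.
  rewrite !vtxE ?Pn //; last by case: ifP; lia.
  have p0 : point2 a b 0 = 0 by [].
  have pS j : point2 a b j.+1 = if j == b then a + 1 else 2 * a + 2 + j.
    by rewrite /point2 /= addn1 eqSS; case: eqP; lia.
  case: i le => [|i] le; rewrite ?p0 ?eqSS ?pS.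
    by constructor 1; split=> //; case: eqP => e; [left|right]; lia.
  case: (eqVneq i b) => ne; first by constructor 2.
  by rewrite pS; constructor 4; split; [|case: eqP => e; [left|right]]; lia.
constructor 3; rewrite (sigma_path_out vn).
have := vP 0; have := vP b.+1; rewrite /point2 /= addn1 eqxx => v1 v0.
split=> //; try lia.
rewrite leqNgt; apply/negP => lt; apply: (vP (v - (2 * a + 1))).
  by have := ltn_ord v; lia.
by rewrite /point2 !ifN; have := ltn_ord v; lia.
Qed.

Let sigma3 v : [\/
  v = 0 :> nat /\ sigma_path (vtx 0) path3 v = 2 * a + 1 :> nat,
  v = a + 1 :> nat /\ sigma_path (vtx 0) path3 v = 0 :> nat,
  [/\ a + 2 <= v, v <= 2 * a + 1 & sigma_path (vtx 0) path3 v = v.-1 :> nat] |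
  (0 < v <= a \/ 2 * a + 2 <= v) /\ sigma_path (vtx 0) path3 v = v :> nat].
Proof.
have Pp := arc_points3 b a_gt0; have [[i le ->]|[vn vP]] := in_arc v Pp.
  rewrite (sigma_arc Pp le) /point3; have [->|i0] := posnP i.
    by rewrite /= !vtxE; try lia; constructor 1; split=> //; lia.
  case: (eqVneq i a.+1) => [->|ne]; rewrite /= !vtxE; try lia.
    by constructor 2; split=> //; lia.
  by constructor 3; split; lia.
constructor 4; rewrite (sigma_path_out vn); split=> //.
have v0 := vP 0 (leq0n _); rewrite /point3 /= in v0.
have [le|lt] := leqP v a; first by left; lia.
right; rewrite leqNgt; apply/negP => le; apply: (vP (2 * a + 2 - v)); first by lia.
by rewrite /point3 ifN; lia.
Qed.

(** ** Three loops and their commutators *)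

Let c13 := loop path1 path3.
Let c12 := loop path1 path2.
Let c32 := loop path3 path2.

Local Ltac pick := first [by exfalso; lia | do 6?[first [by left; lia | right]]; lia].

Lemma loop13 v : v = 0 :> nat /\ c13 v = 0 :> nat \/
  0 < v <= 2 * a /\ c13 v = v.+1 :> nat \/
  v = 2 * a + 1 :> nat /\ c13 v = 1 :> nat \/
  2 * a + 2 <= v /\ c13 v = v :> nat.
Proof.
pose u := ((sigma_path (vtx 0) path3)^-1)%g v.
have ev : v = sigma_path (vtx 0) path3 u by rewrite permKV.
rewrite ev /c13 loopE -ev; have := sigma3 u; have := sigma1 u; rewrite -ev.
move: (sigma_path (vtx 0) path1 u) => w.
by case=> [] [? ?]; case=> [[]|[]|[]|[]] *; pick.
Qed.

Lemma loop12 v : v = 0 :> nat /\ c12 v = 0 :> nat \/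
  0 < v <= a /\ c12 v = v.+1 :> nat \/
  v = a + 1 :> nat /\ b = 0 /\ c12 v = 1 :> nat \/
  v = a + 1 :> nat /\ 0 < b /\ c12 v = n :> nat \/
  a + 2 <= v <= 2 * a + 1 /\ c12 v = v :> nat \/
  v = 2 * a + 2 :> nat /\ c12 v = 1 :> nat \/
  2 * a + 3 <= v /\ c12 v = v.-1 :> nat.
Proof.
pose u := ((sigma_path (vtx 0) path2)^-1)%g v.
have ev : v = sigma_path (vtx 0) path2 u by rewrite permKV.
have ltu := ltn_ord u.
rewrite ev /c12 loopE -ev; have := sigma2 u; have := sigma1 u; rewrite -ev.
move: (sigma_path (vtx 0) path1 u) => w.
by case=> [] [? ?]; case=> [[? [?|?]]|[? ?]|[? ? ? ?]|[? [?|?]]]; pick.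
Qed.

Lemma loop32 v : v = 0 :> nat /\ c32 v = 0 :> nat \/
  0 < v <= a /\ c32 v = v :> nat \/
  v = a + 1 :> nat /\ b = 0 /\ c32 v = 2 * a + 1 :> nat \/
  v = a + 1 :> nat /\ 0 < b /\ c32 v = n :> nat \/
  a + 2 <= v <= 2 * a + 1 /\ c32 v = v.-1 :> nat \/
  v = 2 * a + 2 :> nat /\ c32 v = 2 * a + 1 :> nat \/
  2 * a + 3 <= v /\ c32 v = v.-1 :> nat.
Proof.
pose u := ((sigma_path (vtx 0) path2)^-1)%g v.
have ev : v = sigma_path (vtx 0) path2 u by rewrite permKV.
have ltu := ltn_ord u.
rewrite ev /c32 loopE -ev; have := sigma2 u; have := sigma3 u; rewrite -ev.
move: (sigma_path (vtx 0) path3 u) => w.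
by case=> [[? ?]|[? ?]|[? ? ?]|[[?|?] ?]]; case=> [[? [?|?]]|[? ?]|[? ? ? ?]|[? [?|?]]]; pick.
Qed.

Lemma tperm_vtx i j v : i <= n -> j <= n ->
  tperm (vtx i) (vtx j) v = (if v == i :> nat then j else if v == j :> nat then i else v) :> nat.
Proof.
move=> lei lej; case: tpermP => [->|->|vi vj]; rewrite ?vtxE ?eqxx //.
  by case: eqP.
by do 2![case: eqP => [e|_]; first by [case: vi; rewrite -e vtx_id | case: vj; rewrite -e vtx_id]].
Qed.

Let H := [group of stable_positions].
Let c13H : c13 \in H. Proof. by apply: loop_stable; rewrite !inE eqxx ?orbT. Qed.
Let c12H : c12 \in H. Proof. by apply: loop_stable; rewrite !inE eqxx ?orbT. Qed.
Let c32H : c32 \in H. Proof. by apply: loop_stable; rewrite !inE eqxx ?orbT. Qed.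

(* Case analyses on piecewise values explode unless the impossible branches are
   discarded as soon as they appear. *)
Local Ltac split_prune :=
  let h := fresh in intro h; repeat (destruct h as [h|h]); try (exfalso; lia).

(** The commutator of the two cycles [c13] and [c12], which follow the arc
    [path1] in the same direction, moves only the vertices at which they part. *)
Lemma double_transposition : 0 < b ->
  (tperm (vtx (2 * a + 1)) (vtx 1) * tperm (vtx (a + 1)) (vtx n))%g \in H.
Proof.
move=> b0; set delta : position := (_ * _)%g.
suff e : (c13 * c12 = c12 * (delta * c13))%g.
  have -> : (delta = c12^-1 * (c13 * c12) * c13^-1)%g by rewrite e mulKg mulgK.
  by apply: groupM; [apply: groupM; [|exact: groupM]|]; rewrite ?groupV.
have dE v : v = 2 * a + 1 :> nat /\ delta v = 1 :> nat \/
    v = 1 :> nat /\ delta v = 2 * a + 1 :> nat \/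
    v = a + 1 :> nat /\ delta v = n :> nat \/
    v = n :> nat /\ delta v = a + 1 :> nat \/
    v <> 1 :> nat /\ v <> 2 * a + 1 :> nat /\ v <> a + 1 :> nat /\ v <> n :> nat /\
    delta v = v :> nat.
  by rewrite permM !tperm_vtx; try lia; do ![case: eqP] => *; lia.
have E v : c12 (c13 v) = c13 (delta (c12 v)).
  apply: ord_inj.
  have ltv := ltn_ord v; have := loop13 (delta (c12 v)); have := dE (c12 v).
  have := loop12 v; have := loop12 (c13 v); have := loop13 v.
  move: (c13 (delta (c12 v))) (c12 (c13 v)) (delta (c12 v)) (c12 v) (c13 v).
  by clear -a_gt0 b0 nE ltv; move=> x1 x2 x3 x4 x5; do 5!split_prune; lia.
by apply/permP => v; rewrite (permM c13) (permM c12) (permM delta).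
Qed.

(** Without interior vertices on the middle arc, the two cycles [c12] and [c32]
    meet in a single vertex, and their commutator is a 3-cycle. *)
Lemma cyc3_b0 : b = 0 ->
  cyc3 (vtx a) (vtx (2 * a + 1)) (vtx (a + 1)) \in H.
Proof.
move=> b0; set delta : position := cyc3 _ _ _.
suff e : (c12 * c32 = c32 * (delta * c12))%g.
  have -> : (delta = c32^-1 * (c12 * c32) * c12^-1)%g by rewrite e mulKg mulgK.
  by apply: groupM; [apply: groupM; [|exact: groupM]|]; rewrite ?groupV.
have dE v : v = a :> nat /\ delta v = 2 * a + 1 :> nat \/
    v = 2 * a + 1 :> nat /\ delta v = a + 1 :> nat \/
    v = a + 1 :> nat /\ delta v = a :> nat \/
    v <> 2 * a + 1 :> nat /\ v <> a + 1 :> nat /\ v <> a :> nat /\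
    delta v = v :> nat.
  by rewrite permM !tperm_vtx; try lia; do ![case: eqP] => *; lia.
have E v : c32 (c12 v) = c12 (delta (c32 v)).
  apply: ord_inj.
  have ltv := ltn_ord v; have := loop12 (delta (c32 v)); have := dE (c32 v).
  have := loop32 v; have := loop32 (c12 v); have := loop12 v.
  move: (c12 (delta (c32 v))) (c32 (c12 v)) (delta (c32 v)) (c32 v) (c12 v).
  by clear -a_gt0 b0 nE ltv; move=> x1 x2 x3 x4 x5; do 5!split_prune; lia.
by apply/permP => v; rewrite (permM c12) (permM c32) (permM delta).
Qed.

Lemma loop13X v m : 0 < v <= 2 * a + 1 -> m <= 2 * a + 1 ->
  (c13 ^+ m)%g v = (if v + m <= 2 * a + 1 then v + m else v + m - (2 * a + 1)) :> nat.
Proof.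
move=> vr; elim: m => [|m IH] lem; first by rewrite perm1 addn0; case: ifP; lia.
have -> : (c13 ^+ m.+1)%g v = c13 ((c13 ^+ m)%g v) by rewrite expgSr permM.
have := loop13 ((c13 ^+ m)%g v); rewrite IH; last exact: ltnW.
by case: ifP => e1; case: ifP => e2; lia.
Qed.

Lemma loop13X_fix v m : 2 * a + 2 <= v -> (c13 ^+ m)%g v = v.
Proof.
move=> vr; elim: m => [|m IH]; first by rewrite perm1.
have -> : (c13 ^+ m.+1)%g v = c13 ((c13 ^+ m)%g v) by rewrite expgSr permM.
by rewrite IH; apply: ord_inj; have := loop13 v; lia.
Qed.

Let perm_vtx (s : position) i j : i <= n -> j <= n ->
  s (vtx i) = j :> nat -> s (vtx i) = vtx j.
Proof. by move=> lei lej e; apply: ord_inj; rewrite e vtxE. Qed.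

Let loop12V i j : i <= n -> j <= n -> c12 (vtx i) = j :> nat ->
  (c12^-1)%g (vtx j) = vtx i.
Proof.
by move=> lei lej /(perm_vtx lei lej) <-; rewrite permK.
Qed.

(** The conjugation by [c12^-1 * c13 ^+ a.+1] turns the double transposition
    into one that shares a transposition with it. *)
Lemma cyc3_b_ge2 : 1 < b -> cyc3 (vtx (a + 1)) (vtx (2 * a + 2)) (vtx n) \in H.
Proof.
move=> b1; have dH := double_transposition (ltnW b1).
set g : position := (c12^-1 * c13 ^+ a.+1)%g.
have gH : g \in H by rewrite groupM ?groupV ?groupX.
have gE i i' j : i <= n -> i' <= n -> j <= n -> c12 (vtx i') = i :> nat ->
    (c13 ^+ a.+1)%g (vtx i') = j :> nat -> g (vtx i) = vtx j.
  move=> li li' lj ei ej; rewrite permM (loop12V li' li ei).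
  exact: perm_vtx.
have := groupM (groupJ dH gH) dH; rewrite conjMg !tpermJ.
have -> : g (vtx (2 * a + 1)) = vtx (a + 1).
  apply: (@gE _ (2 * a + 1)); try lia.
    by have := loop12 (vtx (2 * a + 1)); rewrite vtxE; lia.
  by rewrite loop13X ?vtxE //; try lia; case: ifP; lia.
have -> : g (vtx 1) = vtx (2 * a + 2).
  apply: (@gE _ (2 * a + 2)); try lia.
    by have := loop12 (vtx (2 * a + 2)); rewrite vtxE; lia.
  by rewrite loop13X_fix ?vtxE //; lia.
have -> : g (vtx (a + 1)) = vtx (2 * a + 1).
  apply: (@gE _ a); try lia.
    by have := loop12 (vtx a); rewrite vtxE; lia.
  by rewrite loop13X ?vtxE //; try lia; case: ifP; lia.
have -> : g (vtx n) = vtx 1.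
  apply: (@gE _ (a + 1)); try lia.
    by have := loop12 (vtx (a + 1)); rewrite vtxE; lia.
  by rewrite loop13X ?vtxE //; try lia; case: ifP; lia.
by rewrite mulgA -(mulgA _ _ (tperm (vtx (2 * a + 1)) _)) tperm2 mulg1.
Qed.

(** With one interior vertex on the middle arc, a double transposition and its
    conjugate by the square of [c13] share only that vertex. This needs the
    cycle [c13] to be long enough, hence [2 < a]. *)
Lemma cyc3_b1 : b = 1 -> 2 < a -> cyc3 (vtx (a + 3)) (vtx (a + 1)) (vtx n) \in H.
Proof.
move=> b1 a3; have b0 : 0 < b by rewrite b1.
have dH := double_transposition b0.
have gH : (c13 ^+ 2)%g \in H by apply: groupX.
have := groupX 2 (groupM dH (groupJ dH gH)); rewrite conjMg !tpermJ.
have -> : (c13 ^+ 2)%g (vtx (2 * a + 1)) = vtx 2.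
  by apply: perm_vtx; rewrite ?loop13X ?vtxE; try lia; case: ifP; lia.
have -> : (c13 ^+ 2)%g (vtx 1) = vtx 3.
  by apply: perm_vtx; rewrite ?loop13X ?vtxE; try lia; case: ifP; lia.
have -> : (c13 ^+ 2)%g (vtx (a + 1)) = vtx (a + 3).
  by apply: perm_vtx; rewrite ?loop13X ?vtxE; try lia; case: ifP; lia.
have -> : (c13 ^+ 2)%g (vtx n) = vtx n.
  by apply: loop13X_fix; rewrite vtxE; lia.
rewrite double_tperm_square //.
have -> : [:: vtx (2 * a + 1); vtx 1; vtx (a + 1); vtx 2; vtx 3; vtx (a + 3); vtx n]
   = map vtx [:: 2 * a + 1; 1; a + 1; 2; 3; a + 3; n] by [].
rewrite map_inj_in_uniq; first by rewrite /= !inE; lia.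
move=> i j /= ii jj /(congr1 val) /=; rewrite !vtxE //.
  by move: jj; rewrite !inE; lia.
by move: ii; rewrite !inE; lia.
Qed.

Let linkedS s i j m : s \in H -> i <= n -> j <= n -> m <= n ->
  s (vtx m) = m :> nat -> s (vtx i) = j :> nat ->
  linked H (vtx m) (vtx i) -> linked H (vtx m) (vtx j).
Proof.
move=> sH li lj lm em ej /(linkedJ sH).
by rewrite (perm_vtx lm lm em) (perm_vtx li lj ej).
Qed.

Let ascend (Q : nat -> Prop) lo hi : (forall i, lo <= i < hi -> Q i -> Q i.+1) ->
  Q lo -> forall i, lo <= i <= hi -> Q i.
Proof.
move=> up Qlo i; elim: i => [|i IH] ir; first by have <- : lo = 0 by lia.
by have [<-//|ne] := eqVneq lo i.+1; apply: up; [lia|apply: IH; lia].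
Qed.

Let descend (Q : nat -> Prop) lo hi : (forall i, lo < i <= hi -> Q i -> Q i.-1) ->
  Q hi -> forall i, lo <= i <= hi -> Q i.
Proof.
move=> dn Qhi i ir; have -> : i = hi - (hi - i) by lia.
apply: (@ascend (fun j => Q (hi - j)) 0 (hi - lo)); last by lia.
  by move=> j jr Qj; rewrite subnS; apply: dn => //; lia.
by rewrite subn0.
Qed.

(** Each of the three cycles fixes the interior of an arc, so a link between
    points of two different arcs spreads along both of them. *)
Lemma all_linked : b != 1 \/ 2 < a ->
  forall i, 0 < i <= n -> linked H (vtx 1) (vtx i).
Proof.
move=> hyp; have u3 i j m : i <= n -> j <= n -> m <= n ->
    uniq [:: i; j; m] -> uniq [:: vtx i; vtx j; vtx m].
  move=> li lj lm; rewrite -[[:: vtx i; _; _]]/(map vtx [:: i; j; m]).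
  rewrite map_inj_in_uniq // => x y; rewrite !inE => xr yr /(congr1 (@nat_of_ord _)).
  by rewrite !vtxE //; lia.
have down32 i : a + 2 <= i <= n -> i != 2 * a + 2 ->
    linked H (vtx 1) (vtx i) -> linked H (vtx 1) (vtx i.-1).
  move=> ir ne; apply: (linkedS c32H); try lia.
    by have := loop32 (vtx 1); rewrite vtxE; lia.
  by have := loop32 (vtx i); rewrite vtxE; lia.
have [b0|b0] := posnP b.
  pose Q i := linked H (vtx (2 * a + 1)) (vtx i).
  have e12 : c12 (vtx (2 * a + 1)) = 2 * a + 1 :> nat.
    by have := loop12 (vtx (2 * a + 1)); rewrite vtxE; lia.
  have Qa : Q a.
    apply: linked_sym; apply: cyc3_linked (cyc3_b0 b0) _.
    by apply: u3; rewrite /= ?inE; lia.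
  have Qup i : 0 < i <= a -> Q i -> Q i.+1.
    move=> ir; apply: (linkedS c12H); try lia.
    by have := loop12 (vtx i); rewrite vtxE; lia.
  have Qa1 : Q (a + 1) by rewrite addn1; apply: Qup => //; lia.
  have Q1 : Q 1.
    apply: linkedS c12H _ _ _ e12 _ Qa1; try lia.
    by have := loop12 (vtx (a + 1)); rewrite vtxE; lia.
  have l1 : linked H (vtx 1) (vtx (2 * a + 1)) by apply: linked_sym.
  move=> i ir; have [le|gt] := leqP i (a + 1).
  - apply: linked_trans l1 _; apply: (@ascend Q 1 (a + 1)) => // [j jr|]; last by lia.
    by apply: Qup; lia.
  - apply: (@descend (fun i => linked H (vtx 1) (vtx i)) (a + 2) (2 * a + 1)) => //; last by lia.
    by move=> j jr; apply: down32; lia.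
have an : linked H (vtx (a + 1)) (vtx n).
  have [b1|b1] := eqVneq b 1.
    have a3 : 2 < a by case: hyp; rewrite ?b1.
    have u : uniq [:: vtx (a + 3); vtx (a + 1); vtx n] by apply: u3; rewrite /= ?inE; lia.
    have := cyc3_b1 b1 a3; rewrite cyc3_rot // => /cyc3_linked; apply.
    by rewrite -uniq3_rot.
  have b2 : 1 < b by lia.
  have u : uniq [:: vtx (a + 1); vtx (2 * a + 2); vtx n] by apply: u3; rewrite /= ?inE; lia.
  have := cyc3_b_ge2 b2; rewrite -groupV cyc3V => /cyc3_linked; apply.
  by rewrite uniq3_swap.
pose Q i := linked H (vtx n) (vtx i).
have e13 : c13 (vtx n) = n :> nat by have := loop13 (vtx n); rewrite vtxE; lia.
have Qa : Q (a + 1) by apply: linked_sym.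
have Qup i : 0 < i <= 2 * a -> Q i -> Q i.+1.
  move=> ir; apply: (linkedS c13H); try lia.
  by have := loop13 (vtx i); rewrite vtxE; lia.
have Qtop : Q (2 * a + 1).
  apply: (@ascend Q (a + 1) (2 * a + 1)) => //; last by lia.
  by move=> j jr; apply: Qup; lia.
have Q1 : Q 1.
  apply: linkedS c13H _ _ _ e13 _ Qtop; try lia.
  by have := loop13 (vtx (2 * a + 1)); rewrite vtxE; lia.
have l1 : linked H (vtx 1) (vtx n) by apply: linked_sym.
move=> i ir; have [le|gt] := leqP i (2 * a + 1).
- apply: linked_trans l1 _; apply: (@ascend Q 1 (2 * a + 1)) => // [j jr|]; last by lia.
  by apply: Qup; lia.
- apply: (@descend (fun i => linked H (vtx 1) (vtx i)) (2 * a + 2) n) => //; last by lia.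
  by move=> j jr; apply: down32; lia.
Qed.

End Wilson.

(** * Reachable positions and their parity *)

Section Reversal.
Variable N : nat.

(** The parity of a reversal comes from its decomposition into transpositions
    of symmetric points. *)
Lemma interval_reversal k l : l + k <= N -> exists2 s : {perm 'I_N},
  forall v, s v = (if l <= v < l + k then 2 * l + k - v.+1 else v) :> nat
  & odd_perm s = odd k./2.
Proof.
have [m] := ubnP k; elim: m k l => // m IH [|[|k]] l lt le.
- by exists 1%g; [move=> v; rewrite perm1; case: ifP; lia | rewrite odd_perm1].
- by exists 1%g; [move=> v; rewrite perm1; case: ifP; lia | rewrite odd_perm1].
have [s sE s_odd] : exists2 s : {perm 'I_N},
    forall v, s v = (if l.+1 <= v < l.+1 + k then 2 * l.+1 + k - v.+1 else v) :> nat
    & odd_perm s = odd k./2 by apply: IH; lia.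
have lN : l < N by lia. have hN : l + k.+1 < N by lia.
exists (tperm (Ordinal lN) (Ordinal hN) * s)%g => [v|].
  rewrite permM sE; case: tpermP => [->|->|/eqP vl /eqP vh] /=.
  - by do ![case: ifP]; lia.
  - by do ![case: ifP]; lia.
  - by move: vl vh; rewrite -!val_eqE /= => vl vh; do ![case: ifP]; lia.
rewrite odd_permM odd_tperm s_odd -val_eqE /= (_ : l != l + k.+1) //.
by lia.
Qed.

End Reversal.

Section Reachable.
Variables a b : nat.
Hypothesis a_gt0 : 0 < a.
Notation n := (nlab a b).
Notation position := {perm 'I_n.+1}.
Notation vtx := (@vtx a b).
Notation r := (puz (@theta a b)).
Notation rho := (rho a b).
Notation psi := (psi a b).
Notation arcs := [:: path1 a b; path2 a b; path3 a b].
Notation stable := (lift_perm ord0 ord0).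
Implicit Types (v w : 'I_n.+1) (f g h k : position) (s : {perm 'I_n}).

Let nE : n = 2 * a + b + 1. Proof. by []. Qed.

Lemma stable_tperm (i j : 'I_n) :
  stable (tperm i j) = tperm (lift ord0 i) (lift ord0 j).
Proof.
apply/permP => v; case: (unliftP ord0 v) => [u ->|->].
  rewrite lift_perm_lift; case: (tpermP i j u) => [->|->|ui uj]; rewrite ?tpermL ?tpermR //.
  by rewrite tpermD // (inj_eq lift_inj) eq_sym; apply/eqP.
by rewrite lift_perm_id tpermD // eq_sym neq_lift.
Qed.

Lemma stableM s s' : stable (s * s')%g = (stable s * stable s')%g.
Proof. by rewrite lift_permM. Qed.

Lemma stable_cyc3 (i j m : 'I_n) :
  stable (cyc3 i j m) = cyc3 (lift ord0 i) (lift ord0 j) (lift ord0 m).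
Proof. by rewrite /cyc3 stableM !stable_tperm. Qed.

Lemma stable0 s : stable s ord0 = ord0. Proof. exact: lift_perm_id. Qed.

Lemma stable_inj : injective (fun s => stable s).
Proof.
move=> s s' e; apply/permP => i; apply: (@lift_inj _ ord0).
by rewrite -!(lift_perm_lift ord0 ord0) e.
Qed.

Lemma odd_stable s : odd_perm (stable s) = odd_perm s.
Proof. by rewrite odd_lift_perm. Qed.

Lemma stable_exists f : f ord0 = ord0 -> {s | f = stable s}.
Proof.
move=> f0; have fl i : {j | f (lift ord0 i) = lift ord0 j}.
  case: (unliftP ord0 (f (lift ord0 i))) => [j ->|e]; first by exists j.
  by have := neq_lift ord0 i; rewrite -(inj_eq (@perm_inj _ f)) e f0 eqxx.
have inj : injective (fun i => sval (fl i)).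
  move=> i j e; apply: (@lift_inj _ ord0); apply: (@perm_inj _ f).
  by rewrite (svalP (fl i)) (svalP (fl j)) e.
exists (perm inj); apply/permP => v; case: (unliftP ord0 v) => [u ->|->].
  by rewrite lift_perm_lift permE; exact: svalP (fl u).
by rewrite lift_perm_id.
Qed.

(** The permutations of the tiles that are realised by closed walks of the blank
    at the first hub. *)
Definition tiles : {set {perm 'I_n}} := [set s | stable s \in reachable a b].

Lemma tilesE s : (s \in tiles) = (stable s \in stable_positions a b).
Proof. by rewrite !inE stable0 eqxx andbT. Qed.

Lemma tiles_group_set : group_set tiles.
Proof.
apply/group_setP; split.
  by rewrite tilesE lift_perm1; apply: (group1 [group of stable_positions a b]).
by move=> s s'; rewrite !tilesE stableM; apply: groupM.
Qed.
Canonical tiles_group := Group tiles_group_set.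

Lemma Alt_tiles s : b != 1 \/ 2 < a -> ~~ odd_perm s -> s \in tiles.
Proof.
move=> hyp; apply: (@Alt_sub_of_cyc3 _ [group of tiles]) => i j m u.
rewrite tilesE stable_cyc3.
have L (x : 'I_n) : linked [group of stable_positions a b] (vtx 1) (lift ord0 x).
  rewrite -[lift _ _]vtx_id; apply: all_linked => //.
  by rewrite lift0 /=; have := ltn_ord x.
have T x y := linked_trans (linked_sym (L x)) (L y).
exact: linked_cyc3.
Qed.

(** The loop along the arcs of lengths [a.+1] and [b.+1] is an odd permutation. *)
Lemma tiles_Sym s : odd (a + b) -> (a, b) <> (2, 1) -> s \in tiles.
Proof.
move=> oab ne; have hyp : b != 1 \/ 2 < a.
  case: (eqVneq b 1) => [b1|]; [right|by left].
  by have : a <> 2 by [move=> a2; apply: ne; rewrite a2 b1]; lia.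
have [c ec] : {c | loop (path1 a b) (path2 a b) = stable c}.
  by apply: stable_exists; have := loop_stable a_gt0 (p := path1 a b) (q := path2 a b);
    rewrite !inE !eqxx ?orbT => /(_ isT isT)/andP[_ /eqP].
have ct : c \in tiles.
  by rewrite tilesE -ec; apply: loop_stable => //; rewrite !inE eqxx ?orbT.
have oc : odd_perm c.
  rewrite -odd_stable -ec /loop /pcomp odd_permM odd_permV.
  rewrite !odd_sigma_path ?(arc_uniq (arc_points1 b a_gt0)) ?(arc_uniq (arc_points2 b a_gt0)) //.
  by rewrite (arc_size (arc_points1 b a_gt0)) (arc_size (arc_points2 b a_gt0)) /=; lia.
have [os|es] := boolP (odd_perm s); last exact: Alt_tiles.
by rewrite -(groupMr s ct); apply: Alt_tiles; rewrite // odd_permM os oc.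
Qed.

(** For even [a] and [b] the theta graph is bipartite: each move changes both
    the sign of the position and the colour of the vertex of the blank. *)
Lemma tiles_Alt : ~~ odd a -> ~~ odd b -> forall s, s \in tiles -> ~~ odd_perm s.
Proof.
move=> ea eb s.
(* The indices of the middle arc have the parity opposite to the distance to the
   first hub. *)
pose col v := if v <= 2 * a + 1 then odd v else ~~ odd v.
have adj v w : adjn a b v w -> col v (+) col w.
  rewrite /col => /(adjnP a b) [[-> ? ?]|[-> ->]|[? -> ->]|[? [[-> ->]|[-> ->]]]];
  rewrite ?leq0n /=; do ![case: ifP]; lia.
have colS v w : theta v w -> col v (+) col w.
  by rewrite thetaE => /orP[] /adj //; rewrite addbC.
have inv f : f \in reachable a b -> odd_perm f = col (blank f).
  rewrite inE => /connectP[p pp ->].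
  have : odd_perm (1%g : position) = col (blank 1).
    by rewrite odd_perm1 /blank invg1 perm1.
  elim: p (1%g : position) pp => [|g p IH] h //= /andP[/puzP[w hw ->] gp] eh.
  apply: IH => //; rewrite blank_slide /slide /pcomp odd_permM odd_tperm eh.
  have := colS _ _ hw; have [->|_] := eqVneq (blank h) w; first by rewrite addbb.
  by case: (col w); case: (col (blank h)).
rewrite tilesE inE => /andP[/inv]; rewrite odd_stable => -> _.
by rewrite blank_stable ?stable0 // vtx0.
Qed.

(** Moving the blank of [k] back along an arc gives a position that fixes the
    blank, which is reachable together with [k]. *)
Lemma symmetry_reachable k : k (vtx (a + 1)) = ord0 ->
  (forall s, stable s = k \c (sigma_path (vtx 0) (path1 a b))^-1%g -> s \in tiles) ->
  k \in reachable a b.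
Proof.
move=> k0 ks; have p1 : path1 a b \in arcs by rewrite mem_head.
pose f := k \c (sigma_path (vtx 0) (path1 a b))^-1%g.
have f0 : f ord0 = ord0.
  rewrite /f /pcomp permM; rewrite -[in X in k X](sigma_arc_hubs a_gt0 p1) permK.
  exact: k0.
have [s es] := stable_exists f0.
have : f \in reachable a b by rewrite es; have := ks s (esym es); rewrite inE.
by rewrite -(reachable_sigma a_gt0 p1 f0) /f /pcomp mulKVg.
Qed.

Lemma odd_rho_psi : ~~ odd a -> ~~ odd_perm (rho \c psi).
Proof.
move=> ea; have [s sE os] := @interval_reversal n.+1 (2 * a + 1) 1 ltac:(lia).
have -> : rho \c psi = s.
  apply/permP => v; apply: ord_inj; rewrite (rho_psiE a_gt0) sE.
  by do ![case: ifP]; lia.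
by rewrite os; lia.
Qed.

Lemma odd_psi : ~~ odd a -> 4 %| b -> odd_perm psi.
Proof.
move=> ea b4; have [s1 s1E o1] := @interval_reversal n.+1 (a + 2) 0 ltac:(lia).
have [s2 s2E o2] := @interval_reversal n.+1 a (a + 2) ltac:(lia).
have [s3 s3E o3] := @interval_reversal n.+1 b (2 * a + 2) ltac:(lia).
have -> : psi = (s1 * s2 * s3)%g.
  apply/permP => v; apply: ord_inj; rewrite (psiE a_gt0) !permM s3E s2E s1E.
  by have := ltn_ord v; do ![case: ifP]; lia.
by rewrite !odd_permM o1 o2 o3; lia.
Qed.

End Reachable.

(** * Characteristic polynomials of quotient graphs *)

Section CharPoly.
Local Open Scope ring_scope.

Lemma char_poly_reindex (R : comNzRingType) m (s : 'S_m) (A : 'M[R]_m) :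
  char_poly (\matrix_(i, j) A (s i) (s j)) = char_poly A.
Proof.
have -> : \matrix_(i, j) A (s i) (s j) = perm_mx s *m A *m perm_mx s^-1.
  by apply/matrixP => i j; rewrite -row_permE -col_permE !mxE.
rewrite /char_poly /char_poly_mx.
have -> : 'X%:M - map_mx polyC (perm_mx s *m A *m perm_mx s^-1)
   = perm_mx s *m ('X%:M - map_mx polyC A) *m perm_mx s^-1 :> 'M[{poly R}]_m.
  rewrite !map_mxM !map_perm_mx mulmxBr mulmxBl; congr (_ - _).
  by rewrite scalar_mxC -mulmxA -perm_mxM mulgV perm_mx1 mulmx1.
rewrite !det_mulmx mulrAC -det_mulmx -perm_mxM mulgV perm_mx1 det1.
by rewrite mul1r.
Qed.

(** The involution exchanging the two halves splits the space into its even and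
    its odd part, on which the matrix acts as the sum and the difference. *)
Lemma char_poly_block (R : comNzRingType) m (B C : 'M[R]_m) :
  char_poly (block_mx B C C B) = char_poly (B + C) * char_poly (B - C).
Proof.
set M := char_poly_mx (block_mx B C C B).
pose L : 'M[{poly R}]_(m + m) := block_mx 1%:M 1%:M 0 1%:M.
pose L' : 'M[{poly R}]_(m + m) := block_mx 1%:M (- 1%:M) 0 1%:M.
have e : L *m M *m L' =
    block_mx (char_poly_mx (B + C)) 0 (- map_mx polyC C) (char_poly_mx (B - C)).
  rewrite /M /char_poly_mx map_block_mx scalar_mx_block opp_block_mx add_block_mx.
  rewrite /L /L' !mulmx_block !mul1mx !mul0mx !mulmx1 !mulmx0 !mulmxN !mulmx1.
  rewrite !add0r !addr0 map_mxD map_mxB; congr block_mx; apply/matrixP => i j;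
    by rewrite !mxE; ring.
have detL : \det L = 1 by rewrite det_ublock !det1 mulr1.
have detL' : \det L' = 1 by rewrite det_ublock !det1 mulr1.
have := congr1 determinant e; rewrite det_lblock !det_mulmx detL detL' mul1r mulr1.
by [].
Qed.

Lemma char_polyN (R : comNzRingType) m (A : 'M[R]_m) :
  char_poly (- A) = (-1) ^+ m * (char_poly A \Po - 'X).
Proof.
rewrite /char_poly -(det_map_mx (comp_poly (- 'X))) -detZ; congr (\det _).
apply/matrixP => i j; rewrite !mxE raddfB /= raddfMn /= comp_polyX comp_polyC.
by rewrite mulN1r polyCN opprD !opprK mulNrn opprK.
Qed.

End CharPoly.

Definition nedges (T : finType) (E : choiceType) (G : mgraph T E) x y : nat :=
  #|` [fset e in edge G | (src G e == x) && (tgt G e == y)]%fset|.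

Lemma charpol_enum (T : finType) (E : choiceType) (G : mgraph T E) N (r : 'I_N -> T) :
  injective r -> (forall x, x \in vert G <-> exists i, x = r i) ->
  charpol G = char_poly (\matrix_(i, j) (nedges G (r i) (r j))%:R)%R.
Proof.
move=> rinj rP; have eN : #|vert G| = N.
  have -> : vert G = [set r i | i in 'I_N].
    apply/setP => x; apply/idP/imsetP => [/rP[i ->]|[i _ ->]]; first by exists i.
    by apply/rP; exists i.
  by rewrite card_imset // card_ord.
subst N; have rV i : r i \in vert G by apply/rP; exists i.
pose s i := enum_rank_in (rV i) (r i).
have sE i : enum_val (s i) = r i by rewrite enum_rankK_in.
have sinj : injective s by move=> i j e; apply: rinj; rewrite -!sE e.
rewrite /charpol -(char_poly_reindex (perm sinj)); congr char_poly.
by apply/matrixP => i j; rewrite !mxE !permE !sE.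
Qed.

Section QuotientGraph.
Variables (T : finType) (I : finGroupType) (E : choiceType) (G : mgraph T E).
Variables (actV : T -> I -> T) (actE : E -> I -> E) (H : {group I}).
Local Open Scope group_scope.
Hypothesis actV1 : forall x, actV x 1 = x.
Hypothesis actVM : forall x g h, actV (actV x g) h = actV x (h * g).
Hypothesis actE1 : forall d, actE d 1 = d.
Hypothesis actEM : forall d g h, actE (actE d g) h = actE d (h * g).
Hypothesis free : forall x g h, actV x g = actV x h -> g = h.
Hypothesis src_act : forall d g, src G (actE d g) = actV (src G d) g.
Hypothesis tgt_act : forall d g, tgt G (actE d g) = actV (tgt G d) g.
Hypothesis edge_act : forall d g, g \in H -> d \in edge G -> actE d g \in edge G.

Definition orbV x : {set T} := [set actV x h | h in H].
Definition orbE d : {fset E} := [fset actE d h | h in H]%fset.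
Notation Q := (quotient_graph G H actV actE).

Lemma mem_orbV x : x \in orbV x.
Proof. by apply/imsetP; exists 1; rewrite ?group1 ?actV1. Qed.

Lemma orbV_eq x y : (orbV x == orbV y) = (x \in orbV y).
Proof.
apply/eqP/imsetP => [e|[h hH ->]].
  by have := mem_orbV x; rewrite e => /imsetP.
apply/setP => z; apply/imsetP/imsetP => [[g gH ->]|[g gH ->]].
  by exists (g * h); rewrite ?groupM ?actVM.
by exists (g * h^-1); rewrite ?groupM ?groupV // actVM mulgKV.
Qed.

Lemma orbE_act d h : h \in H -> orbE (actE d h) = orbE d.
Proof.
move=> hH; apply/fsetP => z; apply/imfsetP/imfsetP => /= [[g gH ->]|[g gH ->]].
  by exists (g * h); rewrite ?groupM ?actEM.
by exists (g * h^-1); rewrite ?groupM ?groupV // actEM mulgKV.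
Qed.

Lemma src_orbE d : src Q (orbE d) = orbV (src G d).
Proof.
apply/setP => x; rewrite inE; apply/hasP/imsetP => [[e /imfsetP[h /= hH ->] /eqP<-]|[h hH ->]].
  by exists h; rewrite ?src_act.
exists (actE d h); last by rewrite src_act.
by apply/imfsetP; exists h.
Qed.

Lemma tgt_orbE d : tgt Q (orbE d) = orbV (tgt G d).
Proof.
apply/setP => x; rewrite inE; apply/hasP/imsetP => [[e /imfsetP[h /= hH ->] /eqP<-]|[h hH ->]].
  by exists h; rewrite ?tgt_act.
exists (actE d h); last by rewrite tgt_act.
by apply/imfsetP; exists h.
Qed.

Lemma card_by_target (A : {fset E}) (P : pred E) (t : E -> T) (s : seq T) : uniq s ->
  #|` [fset e in A | P e && (t e \in s)]%fset| =
  \sum_(y <- s) #|` [fset e in A | P e && (t e == y)]%fset|.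
Proof.
elim: s => [|y s IH] /=.
  move=> _; rewrite big_nil; apply/eqP; rewrite cardfs_eq0; apply/eqP/fsetP => e.
  by rewrite !inE !andbF.
move=> /andP[ys us]; rewrite big_cons -IH //.
rewrite -cardfsUI.
set I0 := (X in (_ + #|` X|)%N); have -> : I0 = fset0.
  apply/fsetP => e; rewrite !inE; apply/negP => /andP[/and3P[_ _ /eqP->]].
  by rewrite (negbTE ys) !andbF.
rewrite cardfs0 addn0; congr #|` _|; apply/fsetP => e; rewrite !inE.
by case: (e \in A); case: (P e).
Qed.

(** A free action: an edge orbit between two vertex orbits has exactly one
    member that starts at a given representative. *)
Lemma nedges_quotient x y :
  nedges Q (orbV x) (orbV y) = \sum_(h in H) nedges G x (actV y h).
Proof.
pose F := [fset e in edge G | (src G e == x) && (tgt G e \in orbV y)]%fset.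
have -> : nedges Q (orbV x) (orbV y) = #|` F|.
  have oinj : {in F &, injective orbE}.
    move=> d d'; rewrite !inE => /and3P[_ /eqP dx _] /and3P[_ /eqP d'x _] e.
    have : d \in orbE d' by rewrite -e; apply/imfsetP; exists 1; rewrite ?group1 ?actE1.
    case/imfsetP => h /= hH ed; have := src_act d' h; rewrite -ed dx d'x => ex.
    by have := @free x h 1; rewrite -ex actV1 => /(_ erefl) h1; rewrite ed h1 actE1.
  rewrite /nedges; have -> : [fset O in edge Q | (src Q O == orbV x) &&
      (tgt Q O == orbV y)]%fset = [fset orbE d | d in F]%fset.
    apply/fsetP => O; rewrite !inE /=; apply/andP/imfsetP => /= [[]|[d]].
      case/imfsetP => /= d dG ->; rewrite -[X in X == orbV x]/(src Q (orbE d))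
        -[X in X == orbV y]/(tgt Q (orbE d)) src_orbE tgt_orbE !orbV_eq => /andP[].
      case/imsetP => h hH sd td; exists (actE d h^-1).
        rewrite !inE /= edge_act ?groupV //= src_act sd actVM mulVg actV1 eqxx /=.
        case/imsetP: td => g gH td; apply/imsetP; exists (h^-1 * g).
          by rewrite groupM ?groupV.
        by rewrite tgt_act td actVM.
      by rewrite orbE_act ?groupV.
    rewrite !inE => /and3P[dG /eqP sd td] ->; split.
      by apply/imfsetP; exists d.
    rewrite -[X in X == orbV x]/(src Q (orbE d)) -[X in X == orbV y]/(tgt Q (orbE d)).
    by rewrite src_orbE tgt_orbE !orbV_eq sd mem_orbV td.
  by rewrite card_in_imfset //= size_enum_finmem.
have -> : F = [fset e in edge G | (src G e == x) &&
                 (tgt G e \in [seq actV y h | h <- enum H])]%fset.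
  apply/fsetP => e; rewrite !inE /=; congr [&& _, _ & _].
  by apply/imsetP/mapP => [[h hH ->]|[h hH ->]]; exists h; rewrite ?mem_enum // -mem_enum.
rewrite card_by_target; last by rewrite map_inj_uniq ?enum_uniq // => g h /free.
by rewrite big_map big_enum.
Qed.

End QuotientGraph.

(** * The quotients of the contracted puzzle graph *)

Section Quotients.
Variables a b : nat.
Hypothesis a_gt0 : 0 < a.
Notation n := (nlab a b).
Notation position := {perm 'I_n.+1}.
Notation vtx := (@vtx a b).
Notation rho := (rho a b).
Notation psi := (psi a b).
Notation arcs := [:: path1 a b; path2 a b; path3 a b].
Notation stable := (lift_perm ord0 ord0).
Notation Y := (Ygraph a b).
Implicit Types (f g h k : position) (s u : {perm 'I_n}) (d : walk position).

Let nE : n = 2 * a + b + 1. Proof. by []. Qed.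

Hypothesis rho_reachable : rho \in reachable a b.
Hypothesis psi_reachable : psi \in reachable a b.

Let Kgroup : {group position} := Group (klein_group_set b a_gt0).

Lemma kleinP k :
  reflect [\/ k = 1%g, k = rho, k = psi | k = rho \c psi] (k \in klein a b).
Proof.
rewrite !inE -!orbA; apply: (iffP or4P) => [[] /eqP->|[]->]; rewrite ?eqxx //.
- by constructor 1.
- by constructor 2.
- by constructor 3.
- by constructor 4.
- by constructor 1.
- by constructor 2.
- by constructor 3.
- by constructor 4.
Qed.

Lemma klein_reachable k : k \in klein a b -> k \in reachable a b.
Proof.
case/kleinP => ->; [exact: reachable1|exact: rho_reachable|exact: psi_reachable|].
exact: reachable_act (symmetry_psi b a_gt0) psi_reachable rho_reachable.
Qed.

Lemma Y_vert : vert Y = branch a b.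
Proof. by have [_] := Ygraph_contracted b a_gt0. Qed.

Lemma Y_src : src Y = @wsrc _.
Proof. by have [[_ _ -> _ _] _] := Ygraph_contracted b a_gt0. Qed.

Lemma Y_tgt : tgt Y = @wtgt _.
Proof. by have [[_ _ _ -> _] _] := Ygraph_contracted b a_gt0. Qed.

Lemma Y_edge_act d k : k \in klein a b -> d \in edge Y -> act_walk d k \in edge Y.
Proof.
have [[_ _ _ _ EY] VY] := Ygraph_contracted b a_gt0.
move=> kK; rewrite !EY VY; apply: segment_act; last exact: klein_reachable.
exact: klein_symmetry kK.
Qed.

(** ** The group axioms of the action on positions and on walks *)

Let actV := @act_position n.
Let actE := @act_walk n.

Let actV1 f : actV f 1%g = f. Proof. exact: mul1g. Qed.
Let actVM f g h : actV (actV f g) h = actV f (h * g)%g. Proof. exact: mulgA. Qed.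
Let actE1 d : actE d 1%g = d.
Proof.
case: d => f s; congr (_, _); first exact: actV1.
by rewrite -[RHS]map_id; apply: eq_map => g; apply: actV1.
Qed.
Let actEM d g h : actE (actE d g) h = actE d (h * g)%g.
Proof.
case: d => f s; congr (_, _); first exact: actVM.
by rewrite /= -map_comp; apply: eq_map => x /=; apply: actVM.
Qed.
Let act_free f g h : actV f g = actV f h -> g = h. Proof. exact: mulIg. Qed.
Let src_act d g : src Y (actE d g) = actV (src Y d) g.
Proof. by rewrite Y_src. Qed.
Let tgt_act d g : tgt Y (actE d g) = actV (tgt Y d) g.
Proof. by rewrite Y_tgt; exact: (last_map (fun f => actV f g)). Qed.

Section Subgroup.
Variable H : {group position}.
Hypothesis HK : H \subset klein a b.

Let edge_act d g : g \in H -> d \in edge Y -> actE d g \in edge Y.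
Proof. by move=> /(subsetP HK); apply: Y_edge_act. Qed.

Definition orbit_of f := orbV actV H f.

Lemma Yq_nedges f g : nedges (Yquotient H) (orbit_of f) (orbit_of g) =
  \sum_(h in H) nedges Y f (g \c h).
Proof. exact: (nedges_quotient actV1 actVM actE1 actEM act_free src_act tgt_act edge_act). Qed.

Lemma orbit_eq f g : (orbit_of f == orbit_of g) = (f \in orbit_of g).
Proof. exact: (orbV_eq H actV1 actVM). Qed.

Lemma orbit_ofP f g : reflect (exists2 h, h \in H & f = g \c h) (f \in orbit_of g).
Proof. exact: imsetP. Qed.

Lemma Yq_charpol N (r : 'I_N -> position) :
  (forall i, r i \in branch a b) ->
  (forall i j h, h \in H -> r i = r j \c h -> i = j) ->
  (forall f, f \in branch a b -> exists i, exists2 h, h \in H & f = r i \c h) ->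
  charpol (Yquotient H) =
  char_poly (\matrix_(i, j) (\sum_(h in H) nedges Y (r i) (r j \c h))%:R)%R.
Proof.
move=> rD rinj rsurj; rewrite (@charpol_enum _ _ _ _ (fun i => orbit_of (r i))).
- by congr char_poly; apply/matrixP => i j; rewrite !mxE Yq_nedges.
- move=> i j /eqP; rewrite orbit_eq => /orbit_ofP[h hH e]; exact: rinj e.
move=> x; rewrite /= Y_vert; split=> [/imsetP[f fD ->]|[i ->]].
  have [i [h hH e]] := rsurj f fD; exists i; apply/eqP; rewrite orbit_eq.
  by apply/orbit_ofP; exists h.
by apply/imsetP; exists (r i).
Qed.

End Subgroup.

Lemma nedges_act f g k : k \in klein a b -> nedges Y (f \c k) (g \c k) = nedges Y f g.
Proof.
move=> kK; have le x y h : h \in klein a b -> nedges Y x y <= nedges Y (x \c h) (y \c h).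
  move=> hK; rewrite /nedges.
  have inj : injective (fun d => actE d h).
    by move=> d d' /(congr1 (fun e => actE e h^-1%g)); rewrite !actEM mulVg !actE1.
  set A := (X in #|` X| <= _); set B := (X in _ <= #|` X|).
  have -> : #|` A| = #|` (actE^~ h @` A)%fset| by rewrite (card_imfset _ _ inj).
  apply: fsubset_leq_card; apply/fsubsetP => d /imfsetP[e /=]; rewrite !inE /=.
  move=> /and3P[eY /eqP<- /eqP<-] ->.
  by rewrite (Y_edge_act hK eY) src_act tgt_act !eqxx.
have kV x : (x \c k) \c k = x by apply: act_invol; apply: klein_symmetry kK.
by apply/eqP; rewrite eqn_leq le // andbT -{2}(kV f) -{2}(kV g) le.
Qed.

(** All the arcs lead from one hub to the other. *)
Lemma nedges_same_hub f g : f \in branch a b -> blank f = vtx 0 -> blank g = vtx 0 ->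
  nedges Y f g = 0.
Proof.
move=> fD bf bg; apply/eqP; rewrite cardfs_eq0; apply/eqP/fsetP => d.
rewrite in_fset0; apply/negP; rewrite !inE Y_src Y_tgt => /and3P[dY /eqP df /eqP dg].
have [|p pa ed] := edge_arc a_gt0 dY; first by rewrite df.
have [l [P Pp]] := arcsP a_gt0 pa.
move: bg; rewrite -dg ed /wtgt /= blank_slides df bf (arc_last Pp) => /(congr1 val) /=.
by rewrite !vtxE //; lia.
Qed.

(** ** Representatives of the orbits of the Klein group *)

(** The other positions of the contracted graph are the images of these under
    [rho]. *)
Definition home : {set position} := [set f in branch a b | blank f == vtx 0].

Notation t := (rho \c psi).

Let tV : (t * t = 1)%g.
Proof. by case: (symmetryM (rho_psiC b a_gt0) (symmetry_rho b a_gt0) (symmetry_psi b a_gt0)). Qed.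
Let rhoV' := rhoV b a_gt0.
Let psiV' := psiV b a_gt0.
Let rho_psi : (rho * psi = psi * rho)%g.
Proof. by have := rho_psiC b a_gt0. Qed.

Let rho_hub := rho_hub b a_gt0.
Let rho_hub' := rho_hub' b a_gt0.
Let psi_hub := psi_hub b a_gt0.
Let psi_hub' := psi_hub' b a_gt0.
Let rho_psi_hub := rho_psi_hub b a_gt0.
Let rho_psi_neq1 := rho_psi_neq1 b a_gt0.
Let hubs_neq := hubs_neq b a_gt0.

Lemma blank_klein f k : k \in klein a b -> blank (f \c k) = k (blank f).
Proof. by move=> kK; apply: blank_act; apply: klein_symmetry kK. Qed.

Let KM : {in klein a b &, forall k k', (k * k')%g \in klein a b}.
Proof. by move=> k k'; apply: (@groupM _ Kgroup). Qed.

Let tK : t \in klein a b. Proof. by apply/kleinP; constructor 4. Qed.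
Let rhoK : rho \in klein a b. Proof. by apply/kleinP; constructor 2. Qed.
Let psiK : psi \in klein a b. Proof. by apply/kleinP; constructor 3. Qed.

Lemma branch_klein f k : k \in klein a b -> (f \c k \in branch a b) = (f \in branch a b).
Proof.
move=> kK; apply: branch_actE; [exact: klein_symmetry kK|exact: klein_reachable].
Qed.

Lemma home_t f : f \in home -> f \c t \in home.
Proof.
rewrite inE => /andP[fD /eqP bf].
by rewrite inE branch_klein // fD blank_klein // bf rho_psi_hub eqxx.
Qed.

Lemma branch_home f : f \in branch a b -> f \in home \/ f \c rho \in home.
Proof.
move=> fD; have := fD; rewrite inE => /andP[_ /orP[]] /eqP bf.
  by left; rewrite inE fD bf eqxx.
by right; rewrite inE branch_klein // fD blank_klein // bf rho_hub' eqxx.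
Qed.

(** The only non-trivial element of the Klein group that preserves [home] is
    [rho \c psi]; of each pair that it exchanges, the representative is the one
    of lower rank. *)
Lemma home_representatives : exists m (r : 'I_m -> position),
  [/\ #|home| = m + m, forall i, r i \in home,
      forall i j k, k \in klein a b -> r i = r j \c k -> i = j /\ k = 1%g
    & forall f, f \in branch a b -> exists i, exists2 k, k \in klein a b & f = r i \c k].
Proof.
pose R := [set f in home | enum_rank f < enum_rank (f \c t)].
have tt f : (f \c t) \c t = f by rewrite /pcomp mulgA tV mul1g.
have nt f : f \c t != f.
  apply: contra rho_psi_neq1 => /eqP e; apply/eqP; apply: (mulIg f).
  by rewrite mul1g; exact: e.
have ltt f : f \in home -> (f \in R) = (f \c t \notin R).
  have RE g : (g \in R) = (g \in home) && (enum_rank g < enum_rank (g \c t)).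
    by rewrite inE.
  move=> fh; rewrite !RE tt fh (home_t fh) /=.
  by case: ltngtP => // /ord_inj/enum_rank_inj e; have := nt f; rewrite -e eqxx.
exists #|R|, (fun i : 'I_#|R| => enum_val i); have Rh i : @enum_val _ (mem R) i \in home.
  by have := enum_valP i; rewrite inE => /andP[].
split=> //.
- have -> : home = R :|: [set f \c t | f in R].
    apply/setP => f; rewrite in_setU; apply/idP/orP => [fh|[|]].
    + have [fR|fR] := boolP (f \in R); [by left|right].
      by apply/imsetP; exists (f \c t); rewrite ?tt // -[_ \in R]negbK -ltt.
    + by rewrite inE => /andP[].
    + by case/imsetP => g; rewrite inE => /andP[gh _] ->; apply: home_t.
  rewrite cardsU card_imset; last by move=> f g /(congr1 (fun h => h \c t)); rewrite !tt.
  rewrite (_ : R :&: _ = set0) ?cards0 ?subn0 //.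
  apply/setP => f; rewrite in_setI in_set0; apply/negP => /andP[fR /imsetP[g gR ef]].
  have gh : g \in home by move: gR; rewrite inE => /andP[].
  by have := ltt g gh; rewrite gR -ef fR.
- move=> i j k kK e.
  have iR := enum_valP i; have jR := enum_valP j.
  have bl x : x \in home -> blank x = vtx 0 by rewrite inE => /andP[_ /eqP].
  have := congr1 (@blank a b) e; rewrite blank_klein // !bl //.
  case/kleinP: kK e => -> e.
  + by move=> _; split=> //; apply: enum_val_inj; rewrite e; exact: mul1g.
  + by rewrite rho_hub => /eqP; rewrite (negbTE hubs_neq).
  + by rewrite psi_hub => /eqP; rewrite (negbTE hubs_neq).
  + by have := ltt _ (Rh j); rewrite -e iR jR.
- have H f : f \in home -> exists i : 'I_#|R|, exists2 k, k \in klein a b & f = enum_val i \c k.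
    move=> fh; have [fR|fR] := boolP (f \in R).
      exists (enum_rank_in fR f), 1%g; first by apply/kleinP; constructor 1.
      by rewrite enum_rankK_in // /pcomp mul1g.
    have ftR : f \c t \in R by rewrite -[_ \in R]negbK -ltt.
    by exists (enum_rank_in ftR (f \c t)), t; rewrite ?enum_rankK_in ?tt.
  move=> f /branch_home[/H//|/H[i [k kK e]]]; exists i, (rho * k)%g; first exact: KM.
  have -> : f = (f \c rho) \c rho by rewrite /pcomp mulgA rhoV' mul1g.
  by rewrite e /pcomp mulgA.
Qed.

Let KV k : k \in klein a b -> (k * k = 1)%g.
Proof. by move=> /(klein_symmetry a_gt0)[]. Qed.

(** ** Block form of the adjacency matrices *)

Section Representatives.
Variables (m : nat) (r : 'I_m -> position).
Hypothesis r_home : forall i, r i \in home.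
Hypothesis r_inj : forall i j k, k \in klein a b -> r i = r j \c k -> i = j /\ k = 1%g.
Hypothesis r_surj : forall f, f \in branch a b ->
  exists i, exists2 k, k \in klein a b & f = r i \c k.

Let r_branch i : r i \in branch a b.
Proof. by have := r_home i; rewrite inE => /andP[]. Qed.

Definition edge_mx (k : position) : 'M[rat]_m :=
  (\matrix_(i, j) (nedges Y (r i) (r j \c k))%:R)%R.

(** The orbits of [{1, h}] are represented by the positions [r i] and their
    images under a second involution [c] of the Klein group. *)
Lemma charpol_two_cosets (H : {group position}) h c :
  H :=: [set 1%g; h] -> h \in klein a b -> c \in klein a b -> h != 1%g ->
  c \notin [set 1%g; h] ->
  (forall k, k \in klein a b -> [\/ k = 1%g, k = h, k = c | k = (c * h)%g]) ->
  charpol (Yquotient H) =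
  char_poly (block_mx (edge_mx 1 + edge_mx h) (edge_mx c + edge_mx (h * c))
                      (edge_mx c + edge_mx (h * c)) (edge_mx 1 + edge_mx h))%R.
Proof.
move=> HE hK cK h1 cH Kcases.
have HK : H \subset klein a b.
  by rewrite HE; apply/subsetP => k /set2P[]-> //; apply/kleinP; constructor 1.
have Hk k : k \in H -> k \in klein a b by apply: subsetP.
have cc f : (f \c c) \c c = f by rewrite /pcomp mulgA KV ?mul1g.
pose r' (i : 'I_(m + m)) := match split i with inl j => r j | inr j => r j \c c end.
have r'L i : r' (lshift m i) = r i by rewrite /r' (unsplitK (inl i)).
have r'R i : r' (rshift m i) = r i \c c by rewrite /r' (unsplitK (inr i)).
have cH' k : k \in H -> (c * k)%g != 1%g.
  move=> kH; apply: contra cH => /eqP ck; rewrite -HE.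
  have -> : c = k by apply: (mulgI c); rewrite ck KV.
  by [].
have cH'' k : k \in H -> (k * c)%g != 1%g.
  move=> kH; apply: contra cH => /eqP ck; rewrite -HE.
  have -> : c = k by apply: (mulIg c); rewrite ck KV.
  by [].
have hc : (c * h = h * c)%g.
  by apply: (mulgI (c * h)%g); rewrite KV ?KM // -mulgA (mulgA h) KV // mul1g KV.
have cK1 x : (c * (c * x) = x)%g by rewrite mulgA KV // mul1g.
have cK2 x : (c * (h * (c * x)) = h * x)%g by rewrite (mulgA h c) -hc -mulgA cK1.
have nedges_shift f g : nedges Y (f \c c) g = nedges Y f (g \c c).
  by rewrite -{1}[g]cc nedges_act.
rewrite (@Yq_charpol H HK _ r').
- congr char_poly; apply/matrixP => i j; rewrite mxE HE big_setU1 ?inE 1?eq_sym //=.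
  rewrite big_set1.
  have [i' ->|i' ->] := split_ordP i; have [j' ->|j' ->] := split_ordP j.
  + by rewrite block_mxEul !r'L !mxE natrD.
  + by rewrite block_mxEur r'L r'R !mxE natrD /pcomp !mul1g mulgA.
  + rewrite block_mxEdl r'L r'R !mxE natrD !nedges_shift /pcomp !mul1g.
    by rewrite mulgA hc.
  + rewrite block_mxEdr !r'R !mxE natrD !nedges_shift /pcomp !mul1g.
    by rewrite cK1 cK2.
- move=> i; have [i' ->|i' ->] := split_ordP i; rewrite ?r'L ?r'R //.
  by rewrite branch_klein.
- move=> i j k kH; have kK := Hk k kH.
  have [i' ->|i' ->] := split_ordP i; have [j' ->|j' ->] := split_ordP j;
    rewrite ?r'L ?r'R.
  + by move=> /(r_inj kK)[->].
  + rewrite /pcomp mulgA => /r_inj[|_ /eqP]; first exact: KM.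
    by rewrite (negbTE (cH'' _ kH)).
  + move=> /(congr1 (fun f => f \c c)); rewrite cc /pcomp mulgA => /r_inj[|_ /eqP].
      exact: KM.
    by rewrite (negbTE (cH' _ kH)).
  + move=> /(congr1 (fun f => f \c c)); rewrite cc /pcomp !mulgA => /r_inj[|-> //].
    by do 2?apply: KM.
- move=> f /r_surj[i [k kK ->]]; have hH : h \in H by rewrite HE !inE eqxx orbT.
  have oH : 1%g \in H by rewrite group1.
  case: (Kcases k kK) => ->.
  + by exists (lshift m i), 1%g; rewrite // r'L.
  + by exists (lshift m i), h; rewrite // r'L.
  + by exists (rshift m i), 1%g; rewrite // r'R /pcomp mul1g.
  + by exists (rshift m i), h; rewrite // r'R /pcomp mulgA hc.
Qed.

Let cycle_sub k : k \in klein a b -> k != 1%g -> <[k]>%g = [set 1%g; k].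
Proof.
move=> kK k1; apply: cycle2g; apply/eqP; rewrite eqn_leq order_gt1 k1 andbT.
by apply: dvdn_leq => //; rewrite order_dvdn expgS expg1 KV.
Qed.

Let rho_neq1 : rho != 1%g.
Proof. by apply: contraTneq hubs_neq => e; rewrite -rho_hub e perm1 eqxx. Qed.

Let psi_neq1 : psi != 1%g.
Proof. by apply: contraTneq hubs_neq => e; rewrite -psi_hub e perm1 eqxx. Qed.

Let t_neq k : k (vtx 0) = vtx (a + 1) -> t != k.
Proof. by move=> k0; apply: contraTneq hubs_neq => e; rewrite -k0 -e rho_psi_hub eqxx. Qed.

Let t_rho : (t * rho = psi)%g.
Proof. by rewrite /pcomp -mulgA rhoV' mulg1. Qed.

Let t_psi : (t * psi = rho)%g.
Proof. by rewrite /pcomp -rho_psi -mulgA psiV' mulg1. Qed.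

Let edge_mx1 : edge_mx 1 = 0%R.
Proof.
have bh i : blank (r i) = vtx 0 by have := r_home i; rewrite inE => /andP[_ /eqP].
by apply/matrixP => i j; rewrite !mxE nedges_same_hub // /pcomp mul1g.
Qed.

Let edge_mxt : edge_mx t = 0%R.
Proof.
have bh i : blank (r i) = vtx 0 by have := r_home i; rewrite inE => /andP[_ /eqP].
apply/matrixP => i j; rewrite !mxE nedges_same_hub // blank_klein // bh.
exact: rho_psi_hub.
Qed.

Lemma charpol_rho : charpol (Yquotient <[rho]>%g) =
  char_poly (block_mx (edge_mx rho) (edge_mx psi) (edge_mx psi) (edge_mx rho)).
Proof.
have tN : t \notin [set 1%g; rho] by rewrite in_set2 negb_or rho_psi_neq1 t_neq ?rho_hub.
have cases k : k \in klein a b -> [\/ k = 1%g, k = rho, k = t | k = (t * rho)%g].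
  by rewrite t_rho => /kleinP[] ->; [constructor 1|constructor 2|constructor 4|constructor 3].
have rt : (rho * t = psi)%g by rewrite /pcomp -rho_psi mulgA rhoV' mul1g.
have := charpol_two_cosets (H := <[rho]>%G) (cycle_sub rhoK rho_neq1) rhoK tK rho_neq1 tN cases.
by rewrite edge_mx1 edge_mxt !add0r rt.
Qed.

Lemma charpol_psi : charpol (Yquotient <[psi]>%g) =
  char_poly (block_mx (edge_mx psi) (edge_mx rho) (edge_mx rho) (edge_mx psi)).
Proof.
have tN : t \notin [set 1%g; psi] by rewrite in_set2 negb_or rho_psi_neq1 t_neq ?psi_hub.
have cases k : k \in klein a b -> [\/ k = 1%g, k = psi, k = t | k = (t * psi)%g].
  by rewrite t_psi => /kleinP[] ->; [constructor 1|constructor 4|constructor 2|constructor 3].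
have pt : (psi * t = rho)%g by rewrite /pcomp mulgA psiV' mul1g.
have := charpol_two_cosets (H := <[psi]>%G) (cycle_sub psiK psi_neq1) psiK tK psi_neq1 tN cases.
by rewrite edge_mx1 edge_mxt !add0r pt.
Qed.

Lemma charpol_rho_psi : charpol (Yquotient <[t]>%g) =
  char_poly (block_mx 0 (edge_mx rho + edge_mx psi) (edge_mx rho + edge_mx psi) 0)%R.
Proof.
have rN : rho \notin [set 1%g; t].
  by rewrite in_set2 negb_or rho_neq1 eq_sym t_neq ?rho_hub.
have rt : (rho * t = psi)%g by rewrite /pcomp -rho_psi mulgA rhoV' mul1g.
have cases k : k \in klein a b -> [\/ k = 1%g, k = t, k = rho | k = (rho * t)%g].
  by rewrite rt => /kleinP[] ->; [constructor 1|constructor 3|constructor 4|constructor 2].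
have := charpol_two_cosets (H := <[t]>%G) (cycle_sub tK rho_psi_neq1) tK rhoK rho_psi_neq1 rN cases.
by rewrite edge_mx1 edge_mxt add0r t_rho.
Qed.

Lemma charpol_klein : charpol (Yquotient (klein a b)) = char_poly (edge_mx rho + edge_mx psi)%R.
Proof.
rewrite (@Yq_charpol Kgroup (subxx _) _ r) //.
- congr char_poly; apply/matrixP => i j; rewrite !mxE -natrD; congr (_%:R)%R.
  have -> : (Kgroup : {set position}) = 1%g |: (t |: [set rho; psi]).
    apply/setP => k; rewrite !inE -!orbA; do 4!case: (k == _) => //.
  rewrite big_setU1; last first.
    by rewrite !inE !negb_or eq_sym rho_psi_neq1 eq_sym rho_neq1 eq_sym psi_neq1.
  rewrite big_setU1; last by rewrite !inE negb_or !t_neq ?rho_hub ?psi_hub.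
  have rp : rho != psi.
    by apply: contra rho_psi_neq1 => /eqP e; rewrite /pcomp -e rhoV'.
  rewrite big_setU1 ?inE // big_set1.
  have bh x : blank (r x) = vtx 0 by have := r_home x; rewrite inE => /andP[_ /eqP].
  have -> : nedges Y (r i) (r j \c 1%g) = 0.
    by rewrite nedges_same_hub // /pcomp mul1g.
  have -> // : nedges Y (r i) (r j \c t) = 0.
  by rewrite nedges_same_hub // blank_klein // bh rho_psi_hub.
- by move=> i j k kK /(r_inj kK)[].
Qed.

End Representatives.

(** ** The isomorphism with a Cayley graph *)

Lemma homeP f : reflect (exists2 s, s \in tiles a b & f = stable s) (f \in home).
Proof.
apply: (iffP idP) => [|[s st ->]]; rewrite [_ \in home]inE.
  case/andP=> fD /eqP bf; have f0 : f ord0 = ord0.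
    by apply/eqP; rewrite blankP bf vtx0.
  have [s es] := stable_exists f0; exists s => //.
  by rewrite inE -es; move: fD; rewrite inE => /andP[].
have bs : blank (stable s) = vtx 0 by rewrite blank_stable ?stable0.
rewrite bs eqxx andbT [_ \in branch a b]inE bs hubE // vtxE //= andbT.
by move: st; rewrite inE.
Qed.

Lemma card_home : #|home| = #|tiles a b|.
Proof.
rewrite -(card_imset _ (@stable_inj a b)); apply: eq_card => f.
by apply/homeP/imsetP.
Qed.

Section CayleyIso.
Variables (G : {group {perm 'I_n}}) (k : position).
Hypothesis tilesG : tiles a b =i G.
Hypothesis kK : k \in klein a b.
Hypothesis k0 : k (vtx 0) = vtx (a + 1).
Hypothesis k1 : k (vtx (a + 1)) = vtx 0.

Let k_neq1 : k != 1%g.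
Proof. by apply: contraTneq hubs_neq => e; rewrite -k0 e perm1 eqxx. Qed.

Let HE : <[k]>%g = [set 1%g; k].
Proof.
apply: cycle2g; apply/eqP; rewrite eqn_leq order_gt1 k_neq1 andbT.
by apply: dvdn_leq => //; rewrite order_dvdn expgS expg1 KV.
Qed.

Let HK : <[k]>%g \subset klein a b.
Proof.
by rewrite HE; apply/subsetP => h /set2P[]-> //; apply/kleinP; constructor 1.
Qed.

Notation Q := (Yquotient <[k]>%g).
Notation orb := (orbit_of <[k]>%G).

Let mem_orb f g : (f \in orb g) = (f == g) || (f == g \c k).
Proof.
apply/imsetP/orP => [[h hk ->]|[/eqP->|/eqP->]].
- have : h \in [set 1%g; k] by rewrite -HE.
  by case/set2P => ->; rewrite /actV /act_position /pcomp ?mul1g eqxx; [left|right].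
- by exists 1%g; rewrite ?group1 // /actV /act_position /pcomp mul1g.
- by exists k; rewrite ?cycle_id.
Qed.

(** Each orbit contains exactly one position whose blank is at the first hub. *)
Definition tile_of (O : {set position}) : {perm 'I_n} :=
  odflt 1%g [pick s | stable s \in O].

Lemma tile_of_orb s : tile_of (orb (stable s)) = s.
Proof.
rewrite /tile_of; case: pickP => [u|/(_ s)]; rewrite mem_orb ?eqxx //=.
case/orP=> [/eqP/(@stable_inj a b)//|/eqP/(congr1 (@blank a b))].
rewrite blank_klein // !blank_stable ?stable0 // k0 => /eqP.
by rewrite (negbTE hubs_neq).
Qed.

Lemma Q_vertP O : reflect (exists2 s, s \in G & O = orb (stable s)) (O \in vert Q).
Proof.
apply: (iffP imsetP) => [[f]|[s sG ->]]; rewrite Y_vert; last first.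
  exists (stable s) => //; have : stable s \in home.
    by apply/homeP; exists s; rewrite ?tilesG.
  by rewrite inE => /andP[].
move=> fD ->; have : f \in home \/ f \c k \in home.
  have := fD; rewrite inE => /andP[_ /orP[]] /eqP bf.
    by left; rewrite inE fD bf eqxx.
  by right; rewrite inE branch_klein // fD blank_klein // bf k1 eqxx.
case=> /homeP[s st es]; exists s; rewrite -?tilesG // -es //.
by apply/eqP; rewrite eq_sym (orbit_eq <[k]>%G) mem_orb eqxx orbT.
Qed.

Lemma sigma_arc_k p : p \in arcs -> (sigma_path (vtx 0) p \c k) ord0 = ord0.
Proof. by move=> pa; rewrite /pcomp permM -vtx0 k0 sigma_arc_hubs // vtx0. Qed.

Lemma generatorsP u : reflect
  (exists2 p, p \in arcs & sigma_path (vtx 0) p \c k = stable u) (u \in generators k).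
Proof.
rewrite inE; apply: (iffP hasP) => -[p pa ind]; exists p => //.
  apply/permP => v; case: (unliftP ord0 v) => [w ->|->].
    by rewrite lift_perm_lift; apply/eqP; have /forallP := ind; apply.
  by rewrite sigma_arc_k // stable0.
by apply/forallP => i; rewrite ind lift_perm_lift.
Qed.

Definition arc_orbit s p : {fset walk position} :=
  orbE actE <[k]>%G (stable s, slides (stable s) p).

(** Every edge orbit contains one edge that starts at a position with the blank
    at the first hub, and this edge follows one of the three arcs. *)
Lemma Q_edgeP O : reflect
  (exists2 s, s \in G & exists2 p, p \in arcs & O = arc_orbit s p) (O \in edge Q).
Proof.
apply: (iffP (imfsetP _ _ _ _)) => /= [[d dY ->]|[s sG [p pa ->]]]; last first.
  exists (stable s, slides (stable s) p) => //.
  have /homeP : exists2 u, u \in tiles a b & stable s = stable u.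
    by exists s; rewrite ?tilesG.
  by rewrite inE => /andP[sD /eqP bs]; apply: arc_edge.
have [e eY [be ed]] : exists2 e, e \in edge Y &
    blank (wsrc e) = vtx 0 /\ orbE actE <[k]>%G d = orbE actE <[k]>%G e.
  have dD : wsrc d \in branch a b.
    by have [[_ _ _ _ EY] VY] := Ygraph_contracted b a_gt0; move: dY; rewrite EY VY => /andP[].
  have := dD; rewrite inE => /andP[_ /orP[]] /eqP bd; first by exists d.
  exists (actE d k); first exact: Y_edge_act.
  split; first by rewrite /wsrc /= [blank _]blank_klein // bd k1.
  by rewrite orbE_act ?cycle_id //; apply: actEM.
have [p pa ee] := edge_arc a_gt0 eY be.
have : wsrc e \in home.
  rewrite inE be eqxx andbT.
  by have [[_ _ _ _ EY] VY] := Ygraph_contracted b a_gt0; move: eY; rewrite EY VY => /andP[].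
case/homeP => s st es; exists s; rewrite -?tilesG //; exists p => //.
by rewrite /arc_orbit -es -ee; exact: ed.
Qed.

Let src_arc s p : src Q (arc_orbit s p) = orb (stable s).
Proof. by rewrite (src_orbE _ src_act) Y_src. Qed.

Let tgt_arc s p u : p \in arcs -> sigma_path (vtx 0) p \c k = stable u ->
  tgt Q (arc_orbit s p) = orb (stable (s \c u)).
Proof.
move=> pa eu; rewrite (tgt_orbE _ tgt_act) Y_tgt /wtgt /= last_slides.
apply/eqP; rewrite (orbit_eq <[k]>%G) mem_orb blank_stable ?stable0 //.
by rewrite /pcomp stableM -eu /pcomp !mulgA KV // mul1g eqxx orbT.
Qed.

Lemma arc_tile p u : p \in arcs -> sigma_path (vtx 0) p \c k = stable u -> u \in G.
Proof.
move=> pa eu; rewrite -tilesG inE -eu; apply: reachable_act.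
- exact: klein_symmetry kK.
- exact: klein_reachable.
have e1 : 1%g \c sigma_path (vtx 0) p = sigma_path (vtx 0) p := mulg1 _.
by rewrite -e1 reachable_sigma ?reachable1 ?perm1.
Qed.

Definition tile_edge (O : {fset walk position}) : {perm 'I_n} * {perm 'I_n} :=
  (tile_of (src Q O), tile_of (tgt Q O)).

Lemma tile_edge_arc s p u : p \in arcs -> sigma_path (vtx 0) p \c k = stable u ->
  tile_edge (arc_orbit s p) = (s, s \c u).
Proof. by move=> pa eu; rewrite /tile_edge src_arc (tgt_arc _ pa eu) !tile_of_orb. Qed.

(** An edge orbit is recovered from its two ends because the three arcs give
    distinct permutations. *)
Lemma Yquotient_cayley : mgraph_iso Q (cayley G (generators k)).
Proof.
exists tile_of, tile_edge.
have uP p : p \in arcs -> {u | sigma_path (vtx 0) p \c k = stable u}.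
  by move=> pa; apply: stable_exists; apply: sigma_arc_k.
split.
- by move=> O O' /Q_vertP[s _ ->] /Q_vertP[s' _ ->]; rewrite !tile_of_orb => ->.
- apply/setP => s; apply/imsetP/idP => [[O /Q_vertP[u uG ->] ->]|sG].
    by rewrite tile_of_orb.
  by exists (orb (stable s)); rewrite ?tile_of_orb //; apply/Q_vertP; exists s.
- move=> O O' /Q_edgeP[s _ [p pa ->]] /Q_edgeP[s' _ [p' p'a ->]].
  have [u eu] := uP p pa; have [u' eu'] := uP p' p'a.
  rewrite (tile_edge_arc _ pa eu) (tile_edge_arc _ p'a eu').
  case=> <- e; congr (arc_orbit s _); apply: (sigma_arc_inj a_gt0) => //.
  apply: (mulgI k); have : sigma_path (vtx 0) p \c k = sigma_path (vtx 0) p' \c k.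
    by rewrite eu eu'; congr (stable _); apply: (mulIg s).
  by [].
- apply/fsetP => -[g h]; rewrite !inE /=; apply/imfsetP/and3P => /=.
    case=> O /Q_edgeP[s sG [p pa ->]]; have [u eu] := uP p pa.
    rewrite (tile_edge_arc _ pa eu) => -[-> ->].
    have ug : u \in generators k by apply/generatorsP; exists p.
    split=> //; first by rewrite groupM // (arc_tile pa eu).
    by apply/exists_inP; exists u.
  case=> gG _ /exists_inP[u /generatorsP[p pa eu] /eqP->].
  exists (arc_orbit g p); first by apply/Q_edgeP; exists g => //; exists p.
  by rewrite (tile_edge_arc _ pa eu).
- by [].
Qed.

End CayleyIso.

(** ** The factorisation *)

Section Factorisation.
Local Open Scope ring_scope.

(** With [B] and [C] counting the edges from one representative to the images
    of another under [rho] and under [psi], the quotient by the Klein group has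
    adjacency matrix [B + C]. Exchanging the roles of [rho] and [psi] exchanges
    [B] and [C], which changes the sign of [B - C] only. *)
Lemma charpol_factors : exists B C : 'M[rat]_(#|tiles a b| %/ 2),
  [/\ charpol (Yquotient <[rho]>%g) = char_poly (B + C) * char_poly (B - C),
      charpol (Yquotient <[psi]>%g) = char_poly (B + C) * char_poly (- (B - C)),
      charpol (Yquotient <[t]>%g) = char_poly (B + C) * char_poly (- (B + C))
    & charpol (Yquotient (klein a b)) = char_poly (B + C)].
Proof.
have [m [r [ch rh rinj rsurj]]] := home_representatives.
have -> : (#|tiles a b| %/ 2)%N = m by rewrite -card_home ch addnn -muln2 mulnK.
exists (edge_mx r rho), (edge_mx r psi); split.
- by rewrite (charpol_rho rh rinj rsurj) char_poly_block.
- by rewrite (charpol_psi rh rinj rsurj) char_poly_block addrC opprB.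
- by rewrite (charpol_rho_psi rh rinj rsurj) char_poly_block add0r sub0r.
- exact: charpol_klein.
Qed.

End Factorisation.

End Quotients.

Local Open Scope ring_scope.

Lemma comp_polyNXK (p : {poly rat}) : (p \Po - 'X) \Po - 'X = p.
Proof. by rewrite -comp_polyA raddfN /= comp_polyX opprK comp_polyXr. Qed.

Theorem theorem6 (a b : nat) (G : {group {perm 'I_(nlab a b)}}) :
  (1 <= a)%N ->
  [/\ odd (a + b), (a, b) <> (2, 1)%N & G = ('Sym_('I_(nlab a b)))%G] \/
  [/\ ~~ odd a, (4 %| b)%N & G = ('Alt_('I_(nlab a b)))%G] ->
  let Z := Yquotient (klein a b) in
  let Xrho := Yquotient <[rho a b]>%g in
  let Xpsi := Yquotient <[psi a b]>%g in
  let Xrhopsi := Yquotient <[rho a b \c psi a b]>%g in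
  [/\ mgraph_iso Xrho (cayley G (generators (rho a b))),
      mgraph_iso Xpsi (cayley G (generators (psi a b))),
      (charpol Xrho)%:F / (charpol Z)%:F
        = (-1) ^+ (#|G| %/ 2) *
          ((charpol Xpsi \Po - 'X)%:F / (charpol Z \Po - 'X)%:F)
        :> {fraction {poly rat}}
    & charpol Xrhopsi
        = (-1) ^+ (#|G| %/ 2) * (charpol Z * (charpol Z \Po - 'X))].
Proof.
move=> a_gt0 cases Z Xrho Xpsi Xrhopsi.
have tilesG : tiles a b =i G.
  move=> s; case: cases => [[oab ne ->]|[ea b4 ->]].
    by rewrite tiles_Sym // inE.
  have eb : ~~ odd b by rewrite -dvdn2; apply: dvdn_trans b4.
  rewrite Alt_even; apply/idP/idP => [/(tiles_Alt a_gt0 ea eb)//|es].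
  by apply: Alt_tiles es => //; left; apply: contraTneq b4 => ->.
have reach (k : {perm 'I_(nlab a b).+1}) : k (@vtx a b (a + 1)) = ord0 ->
    (~~ odd a -> (4 %| b)%N -> odd_perm k) -> k \in reachable a b.
  move=> k1 ok; apply: symmetry_reachable => // s es; rewrite tilesG.
  case: cases => [[_ _ ->]|[ea b4 ->]]; first by rewrite inE.
  rewrite Alt_even -odd_stable es /pcomp odd_permM odd_permV ok //.
  rewrite odd_sigma_path ?(arc_uniq (arc_points1 b a_gt0)) //.
  by rewrite (arc_size (arc_points1 b a_gt0)) /= ea.
have rhoW : rho a b \in reachable a b.
  apply: reach => [|ea b4]; first by rewrite (rho_hub' b a_gt0) vtx0.
  have := odd_rho_psi b a_gt0 ea; rewrite /pcomp odd_permM (odd_psi a_gt0 ea b4).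
  by case: odd_perm.
have psiW : psi a b \in reachable a b.
  by apply: reach => [|ea b4]; [rewrite (psi_hub' b a_gt0) vtx0|exact: odd_psi].
have [B [C [eR eP eT eZ]]] := charpol_factors a_gt0 rhoW psiW.
have cardG : #|tiles a b| = #|G| by apply: eq_card.
rewrite cardG in B C eR eP eT eZ.
have cp_neq0 (m : nat) (M : 'M[rat]_m) : char_poly M != 0.
  by rewrite monic_neq0 ?char_poly_monic.
split.
- by apply: Yquotient_cayley => //; [apply/kleinP; constructor 2|exact: rho_hub|exact: rho_hub'].
- by apply: Yquotient_cayley => //; [apply/kleinP; constructor 3|exact: psi_hub|exact: psi_hub'].
- rewrite eR eP eZ comp_polyM !rmorphM /=.
  rewrite [_ * (char_poly (B - C))%:F]mulrC mulfK ?tofrac_eq0 ?cp_neq0 //.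
  rewrite [_ * (char_poly _ \Po - 'X)%:F]mulrC mulfK; last first.
    rewrite tofrac_eq0; apply: contra (cp_neq0 _ (B + C)) => /eqP e.
    by rewrite -[char_poly _]comp_polyNXK e comp_poly0.
  have signE m : ((-1) ^+ m : {poly rat}) \Po - 'X = (-1) ^+ m.
    by rewrite rmorphXn rmorphN1.
  rewrite char_polyN comp_polyM comp_polyNXK signE rmorphM rmorphXn rmorphN1.
  by rewrite mulrA -exprMn mulrNN mulr1 expr1n mul1r.
- by rewrite eT eZ char_polyN mulrCA.
Qed.
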